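(* Let $\Gamma$ be a plumbing tree with one unframed vertex $v_0$, let $G=\Gamma-v_0$, and let $v\in G$ be a vertex which is not adjacent to $v_0$. Let $\Gamma_{+1}(v)$ be obtained from $\Gamma$ by increasing the weight of $v$ by one, and suppose that $G_{+1}(v)=\Gamma_{+1}(v)-v_0$ is negative definite. Then for every $t\in[0,2]$ there is a long exact sequence of $\mathcal{R}$-modules $$\cdots\to t\mathbb{HFK}_p(\Gamma-v)\xrightarrow{\ \phi_*\ }t\mathbb{HFK}_p(\Gamma)\xrightarrow{\ \psi_*\ }t\mathbb{HFK}_p(\Gamma_{+1}(v))\xrightarrow{\ \delta\ }t\mathbb{HFK}_{p-1}(\Gamma-v)\to\cdots$$
   Context: $\Gamma$ is a finite tree with a distinguished unframed vertex $v_0$ and integer weights $e(v)$ on the other vertices; $\Gamma-v$ is $\Gamma$ with $v$ and its edges deleted. For such a graph (or forest) $\Gamma$ with $G=\Gamma-v_0$, $X(G)$ is the associated plumbing of disk bundles over $S^2$, $H_2(X(G);\mathbb{Z})$ is free on the vertices with intersection form $v\cdot v=e(v)$, $v\cdot w=1$ or $0$ according to whether $v,w$ are adjacent or not, assumed negative definite; $v^*\in H^2(X(G);\mathbb{Z})$ is $x\mapsto v\cdot x$; $v_0^*\in H^2(X(G);\mathbb{Z})$ takes the value $1$ on vertices adjacent to $v_0$ and $0$ on the others. $\mathrm{Char}(G)=\{K\in H^2(X(G);\mathbb{Z}): K(x)\equiv x\cdot x \pmod 2\ \forall x\}$. $\mathcal{R}$ is the ring of formal sums $\sum_{\alpha\in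 A}q^\alpha$ over $\mathbb{F}=\mathbb{Z}/2$ with $A\subset\mathbb{R}_{\ge0}$ well-ordered. For $K\in\mathrm{Char}(G)$ and a set $E$ of vertices of $G$ put $g_G[K,E]=\min_{I\subseteq E}\frac12\big(K\cdot I+I^2\big)$, where $I$ is identified with $\sum_{u\in I}u$. For $u\in E$ let $$a_u[K,E]=g_G[K,E-u]-g_G[K,E],\qquad b_u[K,E]=g_G[K+2u^*,E-u]-g_G[K,E]+\tfrac{K\cdot u+u^2}{2},$$ and $a_u(t)=(2-t)a_u[K,E]+t\,a_u[K+2v_0^*,E]$, $b_u(t)=(2-t)b_u[K,E]+t\,b_u[K+2v_0^*,E]$. The chain complex $\mathbb{CF}_t(\Gamma)$ is the $\mathcal{R}$-module of formal, possibly infinite, sums $\sum f_{[K,E]}[K,E]$ with $f_{[K,E]}\in\mathcal{R}$, over all pairs $[K,E]$, $K\in\mathrm{Char}(G)$, $E$ a set of vertices of $G$, with differential $$\partial_t[K,E]=\sum_{u\in E}q^{a_u(t)}[K,E-u]+\sum_{u\in E}q^{b_u(t)}[K+2u^*,E-u].$$ The lattice grading of $[K,E]$ is $|E|$, and $t\mathbb{HFK}_p(\Gamma)$ is the homology of $(\mathbb{CF}_t(\Gamma),\partial_t)$ in lattice grading $p$. *)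

(* Defs.v *)
From HB Require Import structures.
From mathcomp Require Import all_boot all_order all_algebra.
From mathcomp Require Import all_classical all_reals.
From mathcomp Require Import ring lra.

Set Implicit Arguments.
Unset Strict Implicit.
Unset Printing Implicit Defensive.

Import Order.TTheory GRing.Theory Num.Theory.

Local Open Scope classical_set_scope.
Local Open Scope ring_scope.

Section LongSeries.
Variable R : realType.

Definition well_ordered (A : set R) : Prop :=
  forall B : set R, B `<=` A -> B !=set0 ->
    exists2 m, B m & forall x, B x -> m <= x.

Lemma wo_sub (A B : set R) : A `<=` B -> well_ordered B -> well_ordered A.
Proof. by move=> AB wB C CA; apply: wB; apply: subset_trans AB. Qed.

Lemma wo_setU (A B : set R) :
  well_ordered A -> well_ordered B -> well_ordered (A `|` B).
Proof.
move=> wA wB C CAB [c Cc].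
have [[a [Ca Aa]]|nA] := pselect ((C `&` A) !=set0); last first.
  apply: wB; last by exists c.
  by move=> x Cx; case: (CAB _ Cx) => // Ax; case: nA; exists x.
have [[b [Cb Bb]]|nB] := pselect ((C `&` B) !=set0); last first.
  apply: wA; last by exists c.
  by move=> x Cx; case: (CAB _ Cx) => // Bx; case: nB; exists x.
have [m [Cm Am] minm] := wA _ (@subIsetr _ C A) (ex_intro _ a (conj Ca Aa)).
have [n [Cn Bn] minn] := wB _ (@subIsetr _ C B) (ex_intro _ b (conj Cb Bb)).
have [mn|nm] := leP m n.
- exists m => // x Cx; case: (CAB _ Cx) => ?; first exact: minm.
  by apply: (le_trans mn); exact: minn.
- exists n => // x Cx; case: (CAB _ Cx) => ?; last exact: minn.
  by apply: (le_trans (ltW nm)); exact: minm.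
Qed.

Definition sumset (A B : set R) : set R :=
  [set x | exists a b, [/\ A a, B b & x = a + b]].

Lemma wo_sumset (A B : set R) :
  well_ordered A -> well_ordered B -> well_ordered (sumset A B).
Proof.
move=> wA wB.
have step (C : set R) : C `<=` sumset A B -> C !=set0 ->
    exists a b, [/\ A a, B b, C (a + b) &
      forall a' b', A a' -> B b' -> C (a' + b') -> a <= a'].
  move=> CAB [c Cc].
  have [a [Aa [b Bb Cab]] mina] :
      exists2 a, [set a | A a /\ exists2 b, B b & C (a + b)] a &
        forall x, [set a | A a /\ exists2 b, B b & C (a + b)] x -> a <= x.
    apply: wA => [x [] //|].
    by have [a [b [Aa Bb cE]]] := CAB _ Cc; exists a; split=> //; exists b => //;
       rewrite -cE.
  exists a, b; split=> // a' b' Aa' Bb' Cab'.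
  by apply: mina; split=> //; exists b'.
pose good b := forall C : set R, C `<=` sumset A B -> C !=set0 ->
  (forall a' b', A a' -> B b' -> C (a' + b') -> b' < b) ->
  exists2 m, C m & forall x, C x -> m <= x.
have main (C : set R) : C `<=` sumset A B -> C !=set0 ->
    (forall a b, A a -> B b -> C (a + b) -> good b) ->
    exists2 m, C m & forall x, C x -> m <= x.
  move=> CAB C0 gC; have [a [b [Aa Bb Cab mina]]] := step _ CAB C0.
  have [[c [Cc cab]]|nC] :=
      pselect ((C `&` [set x | x < a + b]) !=set0); last first.
    exists (a + b) => // x Cx; rewrite leNgt; apply/negP => xab.
    by apply: nC; exists x.
  have [|||m [Cm mab] minm] := gC _ _ Aa Bb Cab (C `&` [set x | x < a + b]).
  - by move=> x [/CAB].
  - by exists c.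
  - by move=> a' b' Aa' Bb' [Cab' /= lt]; have := mina _ _ Aa' Bb' Cab'; lra.
  exists m => // x Cx; have [xab|] := ltP x (a + b); first exact: minm.
  by apply: le_trans; apply/ltW.
have allgood b : B b -> good b.
  move=> Bb; apply: contrapT => nb.
  have [m [Bm nm] minm] := wB [set b | B b /\ ~ good b] (fun _ => @proj1 _ _)
    (ex_intro _ b (conj Bb nb)).
  apply: nm => C CAB C0 lC; apply: main => // a' b' Aa' Bb' Cab'.
  apply: contrapT => nb'; have := minm b' (conj Bb' nb').
  by rewrite leNgt (lC a' b').
by move=> C CAB C0; apply: main => // a b _ /allgood.
Qed.

Lemma wo_finite (S : set R) : well_ordered S -> well_ordered [set - x | x in S] ->
  finite_set S.
Proof.
move=> w1 w2.
have max (T : set R) : T `<=` S -> T !=set0 -> 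
    exists2 m, T m & forall x, T x -> x <= m.
  move=> TS [y Ty]; have [||_ [m Tm <-] minm] := w2 [set - x | x in T].
  - by move=> _ [x Tx <-]; exists x => //; exact: TS.
  - by exists (- y), y.
  - by exists m => // x Tx; rewrite -lerN2; apply: minm; exists x.
pose T := [set x | S x /\ ~ finite_set (S `&` [set y | y <= x])].
have T0 x : S x -> finite_set (S `&` [set y | y <= x]).
  move=> Sx; apply: contrapT => nx.
  have [m [Sm nm] minm] := w1 T (fun _ => @proj1 _ _) (ex_intro _ x (conj Sx nx)).
  apply: nm.
  suff fin : finite_set (S `&` [set y | y < m]).
    apply: (@sub_finite_set _ _ ((S `&` [set y | y < m]) `|` [set m])).
      move=> y [Sy /=]; rewrite le_eqVlt => /orP[/eqP|]; [by right|by left].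
    by rewrite finite_setU; split.
  have [ne|/nonemptyPn ->//] := pselect ((S `&` [set y | y < m]) !=set0).
  have [n [Sn nltm] maxn] := max _ (@subIsetl _ _ _) ne.
  apply: (@sub_finite_set _ _ (S `&` [set y | y <= n])).
    by move=> y [Sy ym]; split=> //; apply: maxn.
  apply: contrapT => nn; have := minm n (conj Sn nn).
  by rewrite leNgt nltm.
have [ne|/nonemptyPn ->//] := pselect (S !=set0).
have [m Sm maxm] := max _ (@subset_refl _ _) ne.
apply: sub_finite_set (T0 _ Sm) => y Sy; split=> //; exact: maxm.
Qed.

Lemma wo_slice (A B : set R) c : well_ordered A -> well_ordered B ->
  finite_set [set a | A a /\ B (c - a)].
Proof.
move=> wA wB; apply: wo_finite; first by apply: wo_sub wA => x [].
move=> C CS [y Cy].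
have [||m [m' Cm' <-] minm] := wB [set c + x | x in C].
- by move=> _ [x /CS [a [_ ?] <-] <-].
- by exists (c + y), y.
exists m' => // x Cx; have := minm (c + x) (ex_intro2 _ _ x Cx erefl).
by rewrite lerD2l.
Qed.

(* A formal sum \sum_{a in A} q^a over F_2 is encoded by the characteristic
   function of A. *)
Definition supp (f : R -> 'F_2) : set R := [set x | f x != 0].

Definition long_pred : pred (R -> 'F_2) := fun f =>
  `[< (forall x, supp f x -> 0 <= x) /\ well_ordered (supp f) >].

Lemma long_zmod_closed : zmod_closed long_pred.
Proof.
have z x : ~ supp (0 : R -> 'F_2) x by move/eqP; apply.
split=> [|f g /asboolP[f0 wf] /asboolP[g0 wg]]; apply/asboolP.
  by split=> [x /z|B Bs [x /Bs/z]].
have sub : supp (f - g) `<=` supp f `|` supp g.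
  move=> x; apply: contraPP => /not_orP[/negP + /negP].
  by rewrite !negbK /supp /= => /eqP fx /eqP gx; rewrite -[(f - g) x]/(f x - g x) fx gx subrr eqxx.
split=> [x /sub[]|]; [exact: f0|exact: g0|].
by apply: wo_sub sub _; apply: wo_setU.
Qed.

HB.instance Definition _ := GRing.isZmodClosed.Build (R -> 'F_2) long_pred
  long_zmod_closed.

Record long_series := LongSeries { coef : R -> 'F_2; _ : long_pred coef }.

HB.instance Definition _ := [isSub for coef].
HB.instance Definition _ := [Choice of long_series by <:].
HB.instance Definition _ := [SubChoice_isSubZmodule of long_series by <:].

Implicit Types f g h : long_series.

(* The support of the summand is finite for f, g in long_series (slice_fin), so
   that the default value of the sum on infinite supports is never used. *)
Definition conv (f g : R -> 'F_2) : R -> 'F_2 := fun c =>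
  \sum_(a \in [set: R]) f a * g (c - a).

Lemma longP f : (forall x, supp (coef f) x -> 0 <= x) /\ well_ordered (supp (coef f)).
Proof. by case: f => f /= /asboolP. Qed.

Lemma supp_conv f g : supp (conv (coef f) (coef g)) `<=`
  sumset (supp (coef f)) (supp (coef g)).
Proof.
move=> c.
move/(@fsbigN1 _ _ _ R R setT (fun x y => coef f y * coef g (x - y)) c) => -[a _].
rewrite mulf_eq0 negb_or => /andP[fa ga].
by exists a, (c - a); split=> //; rewrite addrC subrK.
Qed.

Lemma conv_subproof f g : long_pred (conv (coef f) (coef g)).
Proof.
have [[f0 wf] [g0 wg]] := (longP f, longP g).
apply/asboolP; split=> [x /supp_conv[a [b [fa gb ->]]]|].
  by apply: addr_ge0; [exact: f0|exact: g0].
exact: wo_sub (@supp_conv f g) (wo_sumset wf wg).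
Qed.

Definition long_mul f g := LongSeries (conv_subproof f g).

Lemma qpow_subproof (x : R) :
  long_pred (fun y => ((0 <= x) && (y == x))%:R : 'F_2).
Proof.
have sE y : supp (fun y => ((0 <= x) && (y == x))%:R : 'F_2) y -> 0 <= x /\ y = x.
  move=> /negP; have [/andP[x0 /eqP->]//|/negbTE nb] := boolP ((0 <= x) && (y == x)).
  by case; apply/eqP.
apply/asboolP; split=> [y /sE[? ->]//|B Bs [y By]].
by exists y => // z /Bs/sE[_ ->]; have /Bs/sE[_ ->] := By.
Qed.

(* Junk value: [qpow x = 0] for [x < 0]; the exponents of the differential are
   nonnegative by at_exp_ge0 and bt_exp_ge0. *)
Definition qpow (x : R) : long_series := LongSeries (qpow_subproof x).

Lemma long_eqP f g : coef f =1 coef g -> f = g.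
Proof. by move=> fg; apply/val_inj/funext. Qed.

Lemma conv_fin f g c (P : set R) :
  finite_set P -> [set a | coef f a != 0 /\ coef g (c - a) != 0] `<=` P ->
  conv (coef f) (coef g) c = \sum_(a \in P) coef f a * coef g (c - a).
Proof.
move=> _ sP; apply/esym; apply: (@fsbig_widen _ _ _ _ P setT) => // a [_ nP] /=; apply/eqP.
rewrite mulf_eq0; apply/negPn/negP; rewrite negb_or => /andP[fa ga]; apply: nP.
exact: sP.
Qed.

Lemma slice_fin f g c : finite_set [set a | coef f a != 0 /\ coef g (c - a) != 0].
Proof.
apply: (@wo_slice (supp (coef f)) (supp (coef g))).
- by case: (longP f).
- by case: (longP g).
Qed.

Lemma long_mulC : commutative long_mul.
Proof.
move=> f g; apply: long_eqP => c /=; rewrite /conv.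
rewrite (reindex_fsbigT (fun a => c - a)); last first.
  by exists (fun a => c - a) => a; rewrite opprB addrC subrK.
by apply: eq_fsbigr => a _; rewrite mulrC; congr (coef g _ * _); ring.
Qed.

Lemma long_mulA : associative long_mul.
Proof.
move=> f g h; apply: long_eqP => c; apply/esym => /=.
have [[[_ wf] [_ wg]] [_ wh]] := (longP f, longP g, longP h).
set A := supp (coef f) in wf; set B := supp (coef g) in wg; set C := supp (coef h) in wh.
pose P := [set a | sumset A B a /\ C (c - a)].
pose Q := [set b | A b /\ sumset B C (c - b)].
have Pfin : finite_set P by apply: wo_slice => //; apply: wo_sumset.
have Qfin : finite_set Q by apply: wo_slice => //; apply: wo_sumset.
have nz a b : coef f b * coef g (a - b) * coef h (c - a) != 0 -> P a /\ Q b.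
  rewrite !mulf_eq0 !negb_or => /andP[/andP[fb gab] hca]; split; split=> //.
    by exists b, (a - b); split=> //; ring.
  by exists (a - b), (c - a); split=> //; ring.
transitivity (\sum_(a \in P) \sum_(b \in Q) coef f b * coef g (a - b) * coef h (c - a)).
  rewrite /long_mul {1}/conv /=.
  rewrite -(fsbig_widen P) //; last first.
    move=> a [_ nP] /=; apply/eqP; rewrite mulf_eq0; apply/negPn/negP.
    by rewrite negb_or => /andP[/supp_conv fg hca]; apply: nP.
  apply: eq_fsbigr => a _; rewrite mulr_fsuml.
  apply/esym; apply: fsbig_widen => // b [_ nQ] /=; apply/eqP/negPn/negP => /nz[_ /nQ]//.
rewrite exchange_fsbig //.
rewrite /= {1}/conv.
rewrite -(@fsbig_widen _ _ _ _ Q setT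
  (fun b => coef f b * conv (coef g) (coef h) (c - b))) //; last first.
  move=> a [_ nP] /=; apply/eqP; rewrite mulf_eq0; apply/negPn/negP.
  by rewrite negb_or => /andP[fa /supp_conv gh]; apply: nP.
apply: eq_fsbigr => b _; rewrite mulr_fsumr.
rewrite (@fsbig_widen _ _ _ _ P setT) //; last first.
  by move=> a [_ nP] /=; apply/eqP/negPn/negP => /nz[/nP].
rewrite (reindex_fsbigT (fun a => a + b)); last first.
  by exists (fun a => a - b) => a; rewrite ?addrK ?subrK.
by apply: eq_fsbigr => a _; rewrite mulrA addrK; congr (_ * coef h _); ring.
Qed.

Lemma coef_qpow x y : coef (qpow x) y = ((0 <= x) && (y == x))%:R.
Proof. by []. Qed.

Lemma conv_qpow x f c : 0 <= x -> conv (coef (qpow x)) (coef f) c = coef f (c - x).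
Proof.
move=> x0; rewrite (@conv_fin _ _ _ [set x]) //.
  by rewrite fsbig_set1 coef_qpow x0 eqxx mul1r.
by move=> a /=; rewrite x0 /=; case: (a =P x) => // _ [] /eqP.
Qed.

Lemma long_mul1 : left_id (qpow 0) long_mul.
Proof. by move=> f; apply: long_eqP => c /=; rewrite conv_qpow// subr0. Qed.

Lemma long_mulDl : left_distributive long_mul +%R.
Proof.
move=> f g h; apply: long_eqP => c /=.
pose P := [set a | coef f a != 0 /\ coef h (c - a) != 0]
  `|` [set a | coef g a != 0 /\ coef h (c - a) != 0]
  `|` [set a | coef (f + g) a != 0 /\ coef h (c - a) != 0].
have Pfin : finite_set P.
  by rewrite !finite_setU; split; [split|]; exact: slice_fin.
rewrite -[(_ + _) c]/(conv (coef f) (coef h) c + conv (coef g) (coef h) c).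
rewrite (@conv_fin f h _ P) // ?(@conv_fin g h _ P) //.
- rewrite -[LHS]/(conv (coef (f + g)) (coef h) c) (@conv_fin (f + g) h _ P) //; last by move=> x ?; right.
  by rewrite -fsbig_split //; apply: eq_fsbigr => a _; exact: mulrDl.
- by move=> x ?; left; right.
- by move=> x ?; left; left.
Qed.

Lemma long_1_neq0 : qpow 0 != 0.
Proof.
apply/eqP => /(congr1 (fun f => coef f 0)).
by rewrite coef_qpow lexx eqxx.
Qed.

HB.instance Definition _ := GRing.Zmodule_isComNzRing.Build long_series
  long_mulA long_mulC long_mul1 long_mulDl long_1_neq0.

Lemma qpowD x y : 0 <= x -> 0 <= y -> qpow (x + y) = qpow x * qpow y.
Proof.
move=> x0 y0; apply: long_eqP => c.
rewrite -[RHS]/(conv (coef (qpow x)) (coef (qpow y)) c) conv_qpow// !coef_qpow.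
by rewrite addr_ge0// y0 subr_eq addrC.
Qed.

Lemma long_addrr f : f + f = 0.
Proof.
apply: long_eqP => c; rewrite -[LHS]/(coef f c + coef f c) -mulr2n -mulr_natr.
by rewrite (_ : 2%:R = 0) ?mulr0 //; apply/val_inj.
Qed.

End LongSeries.

Section GradedComplex.
Variable S : nzRingType.

Record graded_complex := GradedComplex {
  chain :> lmodType S;
  grade : int -> {pred chain};
  grade_closed : forall p, submod_closed (grade p);
  bd : {linear chain -> chain};
  bd_grade : forall p x, x \in grade p -> bd x \in grade (p - 1);
  bdK : forall x, bd (bd x) = 0
}.

Arguments grade : clear implicits.
Arguments bd : clear implicits.

Implicit Types (C D : graded_complex) (p : int).

Definition cycle_pred C p : pred C := fun x => (x \in grade C p) && (bd C x == 0).

Lemma cycle_closed C p : submod_closed (@cycle_pred C p).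
Proof.
have [g0 gD] := @grade_closed C p.
split=> [|a x y /andP[gx /eqP dx] /andP[gy /eqP dy]].
  by rewrite unfold_in /cycle_pred g0 linear0 eqxx.
by rewrite unfold_in /cycle_pred gD // linearP dx dy scaler0 addr0 eqxx.
Qed.

HB.instance Definition _ C p :=
  GRing.isSubmodClosed.Build S C (@cycle_pred C p) (@cycle_closed C p).

Record cycles C p := Cycle { cycle_val : C; _ : cycle_pred p cycle_val }.

HB.instance Definition _ C p := [isSub for @cycle_val C p].
HB.instance Definition _ C p := [Choice of cycles C p by <:].
HB.instance Definition _ C p := [SubChoice_isSubLmodule of cycles C p by <:].

Definition boundaries C p : {pred cycles C p} := fun z =>
  `[< exists2 y, y \in grade C (p + 1) & bd C y = \val z >].

Lemma boundaries_closed C p : submod_closed (@boundaries C p).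
Proof.
have [g0 gD] := @grade_closed C (p + 1).
split=> [|a x y /asboolP[x' gx dx] /asboolP[y' gy dy]]; apply/asboolP.
  by exists 0; rewrite // linear0 linear0.
by exists (a *: x' + y'); rewrite ?gD // linearP dx dy linearP.
Qed.

HB.instance Definition _ C p :=
  GRing.isSubmodClosed.Build S (cycles C p) (@boundaries C p) (@boundaries_closed C p).

Definition homology C p := @Quotient.quot (cycles C p) (@boundaries C p).

HB.instance Definition _ C p := GRing.Zmodule.on (homology C p).

Definition hclass C p (z : cycles C p) : homology C p := (\pi z)%qT.

Lemma hclass_eq C p (x y : cycles C p) :
  hclass x = hclass y <-> x - y \in @boundaries C p.
Proof. by rewrite Quotient.idealrBE; split=> [/eqP|/eqP]. Qed.

Lemma hclass_surj C p (x : homology C p) : exists z, hclass z = x.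
Proof. by exists (repr x); rewrite /hclass reprK. Qed.

Definition homology_scale C p (a : S) (x : homology C p) : homology C p :=
  hclass (a *: repr x).

Lemma homology_scaleE C p a (z : cycles C p) :
  homology_scale a (hclass z) = hclass (a *: z).
Proof.
apply/hclass_eq; rewrite -scalerBr; apply: rpredZ.
by apply/hclass_eq; rewrite /hclass reprK.
Qed.

Lemma hclassD C p (x y : cycles C p) : hclass (x + y) = hclass x + hclass y.
Proof. by rewrite /hclass raddfD. Qed.

Lemma homology_scaleA C p a b (x : homology C p) :
  homology_scale a (homology_scale b x) = homology_scale (a * b) x.
Proof.
by case: (hclass_surj x) => z <-; rewrite !homology_scaleE scalerA.
Qed.

Lemma homology_scale1 C p : left_id 1 (@homology_scale C p).
Proof.
by move=> x; case: (hclass_surj x) => z <-; rewrite homology_scaleE scale1r.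
Qed.

Lemma homology_scaleDr C p : right_distributive (@homology_scale C p) +%R.
Proof.
move=> a x y; case: (hclass_surj x) => z <-; case: (hclass_surj y) => w <-.
by rewrite -hclassD !homology_scaleE scalerDr hclassD.
Qed.

Lemma homology_scaleDl C p (x : homology C p) :
  {morph (@homology_scale C p)^~ x : a b / a + b}.
Proof.
move=> a b; case: (hclass_surj x) => z <-.
by rewrite !homology_scaleE scalerDl hclassD.
Qed.

HB.instance Definition _ C p := GRing.Zmodule_isLmodule.Build S (homology C p)
  (@homology_scaleA C p) (@homology_scale1 C p) (@homology_scaleDr C p)
  (@homology_scaleDl C p).

Lemma hclass_is_linear C p : linear (@hclass C p).
Proof. by move=> a x y; rewrite hclassD -homology_scaleE. Qed.

HB.instance Definition _ C p := GRing.isLinear.Build S (cycles C p) (homology C p)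
  *:%R (@hclass C p) (@hclass_is_linear C p).

Record chain_map C D := ChainMap {
  chain_map_fun :> {linear C -> D};
  chain_map_bd : forall x, bd D (chain_map_fun x) = chain_map_fun (bd C x);
  chain_map_grade : forall p x, x \in grade C p -> chain_map_fun x \in grade D p
}.

Lemma cycle_map_subproof C D (f : chain_map C D) p (z : cycles C p) :
  cycle_pred p (f (\val z)).
Proof.
case: z => x /= /andP[gx /eqP dx]; rewrite /cycle_pred chain_map_grade //=.
by rewrite chain_map_bd dx linear0 eqxx.
Qed.

Definition cycle_map C D (f : chain_map C D) p (z : cycles C p) : cycles D p :=
  Cycle (cycle_map_subproof f z).

Definition hmap C D (f : chain_map C D) p (x : homology C p) : homology D p :=
  hclass (cycle_map f (repr x)).

Lemma hmapE C D (f : chain_map C D) p (z : cycles C p) :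
  hmap f (hclass z) = hclass (cycle_map f z).
Proof.
apply/hclass_eq; have /hclass_eq/asboolP[y gy dy] :
  hclass (repr (hclass z)) = hclass z by rewrite {1}/hclass reprK.
apply/asboolP; exists (f y); first exact: chain_map_grade.
by rewrite chain_map_bd dy !raddfB.
Qed.

Lemma hmap_is_linear C D (f : chain_map C D) p : linear (@hmap C D f p).
Proof.
move=> a x y; case: (hclass_surj x) => z <-; case: (hclass_surj y) => w <-.
rewrite -linearP !hmapE -linearP; congr hclass.
by apply/val_inj; rewrite /= !linearP.
Qed.

HB.instance Definition _ C D f p := GRing.isLinear.Build S (homology C p)
  (homology D p) *:%R (@hmap C D f p) (@hmap_is_linear C D f p).

End GradedComplex.

Definition exact_at (A B C : nmodType) (f : A -> B) (g : B -> C) : Prop :=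
  forall y, g y = 0 <-> exists x, f x = y.

(* The vertices of the graph are [option vertex], with [None] the unframed
   vertex v_0; [vertex] is thus the vertex set of G. *)
Record marked_graph := MarkedGraph {
  vertex : finType;
  adj : rel (option vertex);
  adj_sym : symmetric adj;
  adj_irr : irreflexive adj;
  weight : vertex -> int
}.
Arguments adj : clear implicits.
Arguments weight : clear implicits.

Definition is_tree (Gamma : marked_graph) : Prop :=
  (forall x y, connect (adj Gamma) x y) /\
  (forall s, ucycle (adj Gamma) s -> (size s < 3)%N).

Section DelVertex.
Variables (Gamma : marked_graph) (v : vertex Gamma).

Definition del_adj : rel (option {u : vertex Gamma | u != v}) :=
  fun x y => adj Gamma (omap val x) (omap val y).

Lemma del_adj_sym : symmetric del_adj.
Proof. by move=> x y; apply: adj_sym. Qed.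

Lemma del_adj_irr : irreflexive del_adj.
Proof. by move=> x; apply: adj_irr. Qed.

Definition del_vertex : marked_graph :=
  MarkedGraph del_adj_sym del_adj_irr (fun u => weight Gamma (val u)).

Definition incr_weight : marked_graph :=
  MarkedGraph (@adj_sym Gamma) (@adj_irr Gamma)
    (fun u => if u == v then weight Gamma u + 1 else weight Gamma u).

End DelVertex.

Section Lattice.
Variable Gamma : marked_graph.
Local Notation V := (vertex Gamma).

(* Coordinates on H_2(X(G);Z) in the basis of the vertices, and on
   H^2(X(G);Z) = Hom(H_2(X(G);Z),Z) in the dual basis. *)
Definition H2 := {ffun V -> int}.
Definition coH2 := {ffun V -> int}.

Definition ev (K : coH2) (x : H2) : int := \sum_u K u * x u.

Definition vdot (u w : V) : int :=
  if u == w then weight Gamma u else (adj Gamma (Some u) (Some w))%:Z.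

Definition form (x y : H2) : int := \sum_u \sum_w x u * y w * vdot u w.

Definition negative_definite : Prop := forall x : H2, x != 0 -> form x x < 0.

Definition vtx (u : V) : H2 := [ffun w => (w == u)%:Z].

Definition vset (I : {set V}) : H2 := \sum_(u in I) vtx u.

Definition dual (u : V) : coH2 := [ffun w => vdot u w].

Definition dual0 : coH2 := [ffun w => (adj Gamma None (Some w))%:Z].

Definition char_pred : pred coH2 := fun K =>
  `[< forall x : H2, (ev K x = form x x %[mod 2])%Z >].

Definition Char := {K : coH2 | char_pred K}.

Lemma vdotC u w : vdot u w = vdot w u.
Proof. by rewrite /vdot eq_sym adj_sym; case: eqP => // ->. Qed.

Lemma formC x y : form x y = form y x.
Proof.
rewrite /form exchange_big; apply: eq_bigr => u _; apply: eq_bigr => w _.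
by rewrite vdotC [x _ * _]mulrC.
Qed.

Lemma formDl x y z : form (x + y) z = form x z + form y z.
Proof.
rewrite -big_split; apply: eq_bigr => u _ /=; rewrite -big_split.
by apply: eq_bigr => w _ /=; rewrite ffunE !mulrDl.
Qed.

Lemma formDr x y z : form z (x + y) = form z x + form z y.
Proof. by rewrite !(formC z) formDl. Qed.

Lemma evDl K L x : ev (K + L) x = ev K x + ev L x.
Proof. by rewrite -big_split; apply: eq_bigr => u _; rewrite ffunE mulrDl. Qed.

Lemma evDr K x y : ev K (x + y) = ev K x + ev K y.
Proof. by rewrite -big_split; apply: eq_bigr => u _; rewrite ffunE mulrDr. Qed.

Lemma evMn K x n : ev (K *+ n) x = ev K x *+ n.
Proof. by rewrite -sumrMnl; apply: eq_bigr => u _; rewrite ffunMnE mulrnAl. Qed.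

Lemma evN K x : ev (- K) x = - ev K x.
Proof. by rewrite -sumrN; apply: eq_bigr => u _; rewrite ffunE mulNr. Qed.

Lemma ev_vtx K u : ev K (vtx u) = K u.
Proof.
rewrite /ev (bigD1 u) //= ffunE eqxx mulr1 big1 ?addr0 // => w /negbTE wu.
by rewrite ffunE wu mulr0.
Qed.

Lemma ev_dual u x : ev (dual u) x = form (vtx u) x.
Proof.
rewrite /form (bigD1 u) //= [X in _ + X]big1 ?addr0; last first.
  by move=> w /negbTE wu; apply: big1 => y _; rewrite ffunE wu !mul0r.
by apply: eq_bigr => w _; rewrite !ffunE eqxx mul1r mulrC.
Qed.

Lemma form_vtx u w : form (vtx u) (vtx w) = vdot u w.
Proof. by rewrite -ev_dual ev_vtx ffunE. Qed.

Lemma vset_setU1 u (I : {set V}) : u \notin I -> vset (u |: I) = vtx u + vset I.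
Proof. by move=> uI; rewrite /vset big_setU1. Qed.

Lemma char_shift (K : Char) (x : coH2) : char_pred (val K + x *+ 2).
Proof.
case: K => K /= /asboolP cK; apply/asboolP => y; rewrite -cK evDl evMn -[ev x y *+ 2]mulr_natr.
by rewrite addrC modzMDl.
Qed.

Definition shift (K : Char) (x : coH2) : Char := Sub (val K + x *+ 2) (char_shift K x).

Lemma val_shift K x : val (shift K x) = val K + x *+ 2.
Proof. by []. Qed.

Lemma shift_shift K x y : shift (shift K x) y = shift K (x + y).
Proof. by apply: val_inj; rewrite !val_shift mulrnDl [RHS]addrA. Qed.

Lemma shift0 K : shift K 0 = K.
Proof. by apply: val_inj; rewrite val_shift mul0rn addr0. Qed.

Lemma shiftNK K x : shift (shift K (- x)) x = K.
Proof. by rewrite shift_shift addNr shift0. Qed.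

Lemma shiftK K x : shift (shift K x) (- x) = K.
Proof. by rewrite shift_shift subrr shift0. Qed.

End Lattice.

Section CFt.
Variables (R : realType) (Gamma : marked_graph).
Local Notation V := (vertex Gamma).
Implicit Types (K : Char Gamma) (E I : {set V}) (u w : V).

Definition half_weight K (x : H2 Gamma) : R := (ev (val K) x + form x x)%:~R / 2.

(* The subset [I = set0] contributes 0, so 0 is a harmless unit for the minimum. *)
Definition gmin K E : R :=
  \big[Num.min/0]_(I : {set V} | I \subset E) half_weight K (vset I).

Definition a_exp K E u : R := gmin K (E :\ u) - gmin K E.

Definition b_exp K E u : R :=
  gmin (shift K (dual u)) (E :\ u) - gmin K E + half_weight K (vtx u).

Definition at_exp (t : R) K E u : R :=
  (2 - t) * a_exp K E u + t * a_exp (shift K (dual0 Gamma)) E u.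

Definition bt_exp (t : R) K E u : R :=
  (2 - t) * b_exp K E u + t * b_exp (shift K (dual0 Gamma)) E u.

(* An infinite sum of generators is the family of its coefficients. *)
Definition CF : Type := Char Gamma * {set V} -> (long_series R)^o.
HB.instance Definition _ := GRing.Lmodule.on CF.

(* Coefficient of [K,E] in the differential of f.  Only the finitely many
   generators [K,u|:E] and [K-2u^*,u|:E], u \notin E, contribute to it, so the
   differential of the generators (CFbd_gen) extends to infinite sums. *)
Definition CFbd_fun (t : R) (f : CF) : CF := fun KE =>
  let: (K, E) := KE in
  \sum_(u | u \notin E)
    (qpow (at_exp t K (u |: E) u) * f (K, u |: E) +
     qpow (bt_exp t (shift K (- dual u)) (u |: E) u) *
       f (shift K (- dual u), u |: E)).

Definition gen K E : CF := fun LF => (LF == (K, E))%:R.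

Lemma CFbd_is_linear t : linear (CFbd_fun t).
Proof.
move=> a f g; apply/funext => -[K E] /=.
rewrite -[RHS]/(a * CFbd_fun t f (K, E) + CFbd_fun t g (K, E)) /=.
rewrite mulr_sumr -big_split; apply: eq_bigr => u _ /=.
rewrite -[(_ + g) (K, _)]/(a * f _ + g _) -[(_ + g) (shift _ _, _)]/(a * f _ + g _).
ring.
Qed.

HB.instance Definition _ t :=
  GRing.isLinear.Build (long_series R) CF CF *:%R (CFbd_fun t) (CFbd_is_linear t).

Lemma CFbd_gen t K E : CFbd_fun t (gen K E) =
  \sum_(u in E) (qpow (at_exp t K E u) *: gen K (E :\ u) +
    qpow (bt_exp t K E u) *: gen (shift K (dual u)) (E :\ u)).
Proof.
apply/funext => -[L F]; rewrite fct_sumE /=.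
rewrite [LHS]big_mkcond [RHS]big_mkcond; apply: eq_bigr => u _ /=.
have genE L' F' L'' F'' : gen L' F' (L'', F'') = ((L'' == L') && (F'' == F'))%:R.
  by [].
rewrite -[X in _ = (if _ then X else _)]/(qpow (at_exp t K E u) *
  gen K (E :\ u) (L, F) + qpow (bt_exp t K E u) *
  gen (shift K (dual u)) (E :\ u) (L, F)).
rewrite !genE.
have [/andP[uF /eqP FE]|nFE] := boolP ((u \notin F) && (u |: F == E)).
  have uE : u \in E by rewrite -FE finset.setU11.
  have EF : E :\ u = F by rewrite -FE finset.setU1K.
  rewrite uF uE FE EF !eqxx !andbT; congr (_ + _).
    by have [->//|_] := eqVneq L K; rewrite !mulr0.
  have [<-|LK] := eqVneq (shift L (- dual u)) K; first by rewrite shiftNK eqxx.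
  rewrite mulr0; have [LE|_] := eqVneq L (shift K (dual u)); last by rewrite mulr0.
  by rewrite LE shiftK eqxx in LK.
transitivity (0 : long_series R).
  case: ifP => // uF; move: nFE; rewrite uF /= => /negbTE ->.
  by rewrite !andbF !mulr0 addr0.
case: ifP => // uE; have [FE|_] := eqVneq F (E :\ u).
  by rewrite FE !inE eqxx finset.setD1K ?eqxx ?uE in nFE.
by rewrite !andbF !mulr0 addr0.
Qed.

Lemma gmin_le K E I : I \subset E -> gmin K E <= half_weight K (vset I).
Proof. by move=> IE; rewrite /gmin (bigD1 I) //= ge_min lexx. Qed.

Lemma half_weight0 K : half_weight K (vset finset.set0) = 0.
Proof.
rewrite /half_weight /vset big_set0 /ev /form big1 ?big1 ?addr0 ?mul0r//.
  by move=> u _; rewrite big1// => w _; rewrite ffunE !mul0r.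
by move=> u _; rewrite ffunE mulr0.
Qed.

Lemma gmin_ge K E c : (forall I, I \subset E -> c <= half_weight K (vset I)) ->
  c <= gmin K E.
Proof.
move=> h; apply: (big_ind (fun x => c <= x)) => //.
  by rewrite -(half_weight0 K) h ?finset.sub0set.
by move=> x y cx cy; rewrite le_min cx.
Qed.

Lemma half_weight_setU1 K u I : u \notin I ->
  half_weight K (vset (u |: I)) =
  half_weight (shift K (dual u)) (vset I) + half_weight K (vtx u).
Proof.
move=> uI; rewrite /half_weight vset_setU1// -mulrDl; congr (_ / _).
rewrite -intrD; congr _%:~R; rewrite val_shift evDl evMn ev_dual evDr.
rewrite formDl !formDr (formC (vset I) (vtx u)); ring.
Qed.

Lemma a_exp_ge0 K E u : 0 <= a_exp K E u.
Proof.
rewrite subr_ge0; apply: gmin_ge => I IE; apply: gmin_le.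
by apply: (fintype.subset_trans IE); exact: finset.subsetDl.
Qed.

Lemma b_exp_ge0 K E u : u \in E -> 0 <= b_exp K E u.
Proof.
move=> uE; rewrite /b_exp addrAC subr_ge0 -lerBlDr; apply: gmin_ge => I IE.
have uI : u \notin I.
  by apply/negP => uI; have := fintype.subsetP IE _ uI; rewrite !inE eqxx.
rewrite lerBlDr -half_weight_setU1// gmin_le// finset.subUset finset.sub1set uE.
by apply: (fintype.subset_trans IE); exact: finset.subsetDl.
Qed.

Lemma at_exp_ge0 (t : R) K E u : 0 <= t <= 2 -> 0 <= at_exp t K E u.
Proof.
by move=> /andP[t0 t2]; apply: addr_ge0; apply: mulr_ge0; rewrite ?a_exp_ge0 ?subr_ge0.
Qed.

Lemma bt_exp_ge0 (t : R) K E u : 0 <= t <= 2 -> u \in E -> 0 <= bt_exp t K E u.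
Proof.
by move=> /andP[t0 t2] uE; apply: addr_ge0; apply: mulr_ge0; rewrite ?b_exp_ge0 ?subr_ge0.
Qed.

(* The lattice grading takes values in int, so that the homology in negative
   degrees is zero. *)
Definition CFgrade (p : int) : {pred CF} := fun f =>
  `[< forall K E, f (K, E) != 0 -> #|E|%:Z = p >].

Lemma CFgrade_closed p : submod_closed (CFgrade p).
Proof.
split=> [|a f g /asboolP hf /asboolP hg]; apply/asboolP => K E; first by move/eqP.
rewrite -[(_ + g) _]/(a * f (K, E) + g (K, E)).
have [->|/hf//] := eqVneq (f (K, E)) 0.
by rewrite mulr0 add0r => /hg.
Qed.

Lemma CFbd_grade t p f : f \in CFgrade p -> CFbd_fun t f \in CFgrade (p - 1).
Proof.
move=> /asboolP hf; apply/asboolP => K E; apply: contra_neqP => pE /=.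
apply: big1 => u uE.
have h L : f (L, u |: E) = 0.
  apply: contra_notP pE => /eqP/hf; rewrite finset.cardsU1 uE PoszD => <-.
  by rewrite addrC addKr.
by rewrite !h !mulr0 addr0.
Qed.

Lemma sum_sym_eq0 (T : V -> V -> long_series R) :
  (forall u w, T u w = T w u) -> (forall u, T u u = 0) ->
  \sum_u \sum_w T u w = 0.
Proof.
move=> symT diagT; rewrite pair_bigA /=.
rewrite (bigID (fun p => enum_rank p.1 < enum_rank p.2)%N) /=.
rewrite [X in _ + X](bigID (fun p => p.1 == p.2)) /= [X in _ + (X + _)]big1.
  rewrite add0r [X in _ + X](reindex (fun p : V * V => (p.2, p.1))) /=; last first.
    by exists (fun p : V * V => (p.2, p.1)) => -[].
  rewrite [X in _ + X](eq_bigl (fun p => enum_rank p.1 < enum_rank p.2)%N).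
    under [X in _ + X]eq_bigr do rewrite symT.
    exact: long_addrr.
  move=> [u w] /=; rewrite -leqNgt ltn_neqAle andbC; congr (_ && _).
  by rewrite (inj_eq val_inj) (inj_eq enum_rank_inj) eq_sym.
by move=> [u w] /= /andP[_ /eqP->].
Qed.

Lemma shiftAC K x y : shift (shift K x) y = shift (shift K y) x.
Proof. by rewrite !shift_shift addrC. Qed.

Section Commute.
Variables (t : R) (E : {set V}) (u w : V).
Hypotheses (uE : u \notin E) (wE : w \notin E) (uw : u != w).

Let e1 : (u |: E) :\ u = E. Proof. exact: finset.setU1K. Qed.
Let e2 : (w |: E) :\ w = E. Proof. exact: finset.setU1K. Qed.
Let e3 : (w |: (u |: E)) :\ w = u |: E.
Proof. by rewrite finset.setU1K// !inE negb_or eq_sym uw. Qed.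
Let e4 : (u |: (w |: E)) :\ u = w |: E.
Proof. by rewrite finset.setU1K// !inE negb_or uw. Qed.
Let e5 : w |: (u |: E) = u |: (w |: E). Proof. exact: finset.setUCA. Qed.

Lemma exp_aa K :
  at_exp t K (u |: E) u + at_exp t K (w |: (u |: E)) w =
  at_exp t K (w |: E) w + at_exp t K (u |: (w |: E)) u.
Proof. by rewrite /at_exp /a_exp e1 e2 e3 e4 e5; ring. Qed.

Lemma exp_ab K :
  at_exp t K (u |: E) u + bt_exp t (shift K (- dual w)) (w |: (u |: E)) w =
  bt_exp t (shift K (- dual w)) (w |: E) w +
    at_exp t (shift K (- dual w)) (u |: (w |: E)) u.
Proof.
rewrite /at_exp /bt_exp /a_exp /b_exp e1 e2 e3 e4 e5.
rewrite (shiftAC _ (dual0 _) (dual w)) shiftNK; ring.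
Qed.

Lemma half_weight_swap K :
  half_weight (shift K (- dual u)) (vtx u) +
    half_weight (shift (shift K (- dual u)) (- dual w)) (vtx w) =
  half_weight (shift K (- dual w)) (vtx w) +
    half_weight (shift (shift K (- dual w)) (- dual u)) (vtx u).
Proof.
rewrite /half_weight -!mulrDl -!intrD; congr (_%:~R / _).
rewrite !val_shift !evDl ?evMn !evN !ev_dual !form_vtx (vdotC w u); ring.
Qed.

Lemma exp_bb K :
  bt_exp t (shift K (- dual u)) (u |: E) u +
    bt_exp t (shift (shift K (- dual u)) (- dual w)) (w |: (u |: E)) w =
  bt_exp t (shift K (- dual w)) (w |: E) w +
    bt_exp t (shift (shift K (- dual w)) (- dual u)) (u |: (w |: E)) u.
Proof.
have h := half_weight_swap K; have h0 := half_weight_swap (shift K (dual0 Gamma)).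
rewrite /bt_exp /b_exp e1 e2 e3 e4 e5.
rewrite !(shiftAC _ _ (dual0 _)) !shiftNK.
rewrite (shiftAC K (- dual w) (- dual u)) in h *.
rewrite (shiftAC _ (- dual w) (- dual u)) in h0 *.
move/(canRL (addrK _)) in h; move/(canRL (addrK _)) in h0.
rewrite h h0; ring.
Qed.

End Commute.

Lemma CFbdK (t : R) f : 0 <= t <= 2 -> CFbd_fun t (CFbd_fun t f) = 0.
Proof.
move=> t02; apply/funext => -[K E] /=.
pose T u w := qpow (at_exp t K (u |: E) u) *
  (qpow (at_exp t K (w |: (u |: E)) w) * f (K, w |: (u |: E)) +
   qpow (bt_exp t (shift K (- dual w)) (w |: (u |: E)) w) *
     f (shift K (- dual w), w |: (u |: E))) +
  qpow (bt_exp t (shift K (- dual u)) (u |: E) u) *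
  (qpow (at_exp t (shift K (- dual u)) (w |: (u |: E)) w) *
     f (shift K (- dual u), w |: (u |: E)) +
   qpow (bt_exp t (shift (shift K (- dual u)) (- dual w)) (w |: (u |: E)) w) *
     f (shift (shift K (- dual u)) (- dual w), w |: (u |: E))).
pose P u w := [&& u \notin E, w \notin E & u != w].
transitivity (\sum_u \sum_w if P u w then T u w else 0).
  rewrite big_mkcond; apply: eq_bigr => u _; rewrite /P.
  case: (boolP (u \notin E)) => uE /=; last by rewrite big1.
  rewrite -big_mkcond !mulr_sumr -big_split /=.
  apply: eq_bigl => w.
  by rewrite !inE negb_or andbC eq_sym.
apply: sum_sym_eq0 => [u w|u]; last by rewrite /P eqxx !andbF.
rewrite /P eq_sym andbCA; case: ifP => // /and3P[wE uE wu].
have uw : u != w by rewrite eq_sym.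
rewrite /T !mulrDr !mulrA -!qpowD ?at_exp_ge0 ?bt_exp_ge0 ?finset.setU11//.
rewrite (exp_aa t uE wE uw) (exp_ab t uE wE uw) -(exp_ab t wE uE wu).
rewrite (exp_bb t uE wE uw) (shiftAC K (- dual w)) (finset.setUCA [set w]%SET).
ring.
Qed.

Definition CFt (t : R) (t02 : 0 <= t <= 2) : graded_complex (long_series R) :=
  GradedComplex CFgrade_closed (@CFbd_grade t) (fun f => @CFbdK t f t02).

Definition tHFK (t : R) (t02 : 0 <= t <= 2) (p : int) := homology (CFt t02) p.

End CFt.

(* Main.v *)
(* Write d for the class in H^2 that is 1 on v and 0 on the other vertices.
   There is a short exact sequence of complexes
     0 -> CF_t(Gamma - v) -phi-> CF_t(Gamma) -psi-> CF_t(Gamma_{+1}(v)) -> 0.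
   The map phi sends a generator [K,E] to the sum of all its extensions to
   Gamma, and psi is the theta-like sum, modelled on a blow-down,
     psi [K,E] =
       \sum_{j in Z} q^(G(K + 2jd,E) - G(K,E) + j(j-1)) [K + (2j-1)d, E]
   with G(K,E) = (2-t) g[K,E] + t g[K + 2v_0^*,E].  On a line K + 2Zd with v
   not in E the function G is constant, so that psi is, up to positive powers of
   q, the sum of the identity and of a shift: it is onto, and by the symmetry
   j <-> 1-j its kernel consists of the families that are constant along the
   line, which is the image of phi.  If v is in E then G is concave along the
   line, with slopes decreasing from 2 to 0, and psi is, up to terms that raise
   the q-order by at least 1, the identity plus weighted shifts pointing away from
   the place where the slope crosses 1, hence bijective. *)
From HB Require Import structures.
From mathcomp Require Import all_boot all_order all_algebra.
From mathcomp Require Import all_classical all_reals.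
From mathcomp Require Import ring lra zify.
Require Import Defs.

Set Implicit Arguments.
Unset Strict Implicit.
Unset Printing Implicit Defensive.

Import Order.TTheory GRing.Theory Num.Theory.

Local Open Scope ring_scope.

(** * The long exact homology sequence of a short exact sequence of graded complexes *)

Section LongExactSequence.
Variables (S : nzRingType) (A B C : graded_complex S).
Variables (f : chain_map A B) (g : chain_map B C).
Hypothesis f_inj : forall x, f x = 0 -> x = 0.
Hypothesis gf0 : forall x, g (f x) = 0.
Hypothesis g_ker : forall p y, y \in grade p -> g y = 0 ->
  exists2 x : A, x \in grade p & f x = y.
Hypothesis g_surj : forall p z, z \in grade p ->
  exists2 y : B, y \in grade p & g y = z.

Lemma gradeB (D : graded_complex S) p (x y : D) :
  x \in grade p -> y \in grade p -> x - y \in grade p.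
Proof.
move=> gx gy; have [_ gD] := @grade_closed _ D p.
by rewrite addrC -scaleN1r; apply: gD.
Qed.

Lemma hclass_eq0 (D : graded_complex S) p (z : cycles D p) :
  hclass z = 0 <-> exists2 y : D, y \in grade (p + 1) & bd D y = \val z.
Proof.
have -> : (0 : homology D p) = hclass 0 by rewrite linear0.
rewrite hclass_eq subr0.
by split=> [/asboolP|h]; [|apply/asboolP].
Qed.

Lemma mem_cycle (D : graded_complex S) p (x : D) :
  x \in grade p -> bd D x = 0 -> cycle_pred p x.
Proof. by move=> gx dx; rewrite /cycle_pred gx dx eqxx. Qed.

Lemma cycleP (D : graded_complex S) p (z : cycles D p) :
  \val z \in grade p /\ bd D (\val z) = 0.
Proof. by case: z => x /= /andP[gx /eqP]. Qed.

(** The connecting map of the snake lemma, kept as a relation, so that independence of the lift [y]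
    reduces to [connecting_boundary]. *)
Definition connecting p (z : cycles C p) (w : cycles A (p - 1)) : Prop :=
  exists y : B, [/\ y \in grade p, g y = \val z & bd B y = f (\val w)].

Lemma connecting_total p (z : cycles C p) : exists w, connecting z w.
Proof.
have [gz dz] := cycleP z; have [y gy yz] := g_surj gz.
have [|x gx xy] := g_ker (bd_grade gy); first by rewrite -chain_map_bd yz.
have dx : bd A x = 0 by apply: f_inj; rewrite -chain_map_bd xy bdK.
by exists (Cycle (mem_cycle gx dx)), y.
Qed.

Lemma connecting_linear p a (z z' : cycles C p) w w' :
  connecting z w -> connecting z' w' -> connecting (a *: z + z') (a *: w + w').
Proof.
move=> [y [gy yz yw]] [y' [gy' yz' yw']]; have [_ gD] := @grade_closed _ B p.
exists (a *: y + y'); split; first exact: gD.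
- by rewrite !linearP /= yz yz'.
- by rewrite !linearP /= yw yw'.
Qed.

(** Lift a chain [z2] bounding [z] to [y2]. Then [y - bd B y2] is killed by [g], hence equals some
    [f x], and injectivity of [f] makes [w] the boundary of [x]. *)
Lemma connecting_boundary p (z : cycles C p) w :
  connecting z w -> hclass z = 0 -> hclass w = 0.
Proof.
move=> [y [gy yz yw]] /hclass_eq0[z2 gz2 dz2]; apply/hclass_eq0.
have [y2 gy2 yz2] := g_surj gz2; rewrite subrK.
have gdy2 : bd B y2 \in grade p by rewrite -[p](addrK 1); apply: bd_grade.
have [|x gx xy] := g_ker (gradeB gy gdy2).
  by rewrite linearB /= yz -chain_map_bd yz2 dz2 subrr.
exists x => //; apply/eqP; rewrite -subr_eq0; apply/eqP/f_inj.
by rewrite linearB /= -chain_map_bd xy linearB /= bdK subr0 yw subrr.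
Qed.

Definition delta_fun p (x : homology C p) : homology A (p - 1) :=
  hclass (projT1 (cid (connecting_total (repr x)))).

Lemma delta_funE p (z : cycles C p) w :
  connecting z w -> delta_fun (hclass z) = hclass w.
Proof.
move=> zw; rewrite /delta_fun; case: cid => w' /= zw'.
apply/eqP; rewrite -subr_eq0 -linearB /=; apply/eqP.
(* [z] and its chosen representative differ by a cycle of class zero, which is related to
   [w' - w]. *)
apply: (connecting_boundary (z := -1 *: z + repr (hclass z))).
  by have := connecting_linear (-1) zw zw'; rewrite !scaleN1r [- w + _]addrC.
by rewrite linearP /= scaleN1r {2}/hclass reprK addNr.
Qed.

Lemma delta_fun_is_linear p : linear (@delta_fun p).
Proof.
move=> a x y; case: (hclass_surj x) => z <-; case: (hclass_surj y) => z' <-.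
have [w zw] := connecting_total z; have [w' zw'] := connecting_total z'.
rewrite -linearP (delta_funE zw) (delta_funE zw').
by rewrite (delta_funE (connecting_linear a zw zw')) linearP.
Qed.

HB.instance Definition _ p := GRing.isLinear.Build S (homology C p)
  (homology A (p - 1)) *:%R (@delta_fun p) (@delta_fun_is_linear p).

Lemma exact_middle p : exact_at (hmap f (p := p)) (hmap g (p := p)).
Proof.
move=> x; case: (hclass_surj x) => y <-; have [gy dy] := cycleP y.
split=> [|[x' <-]]; last first.
  case: (hclass_surj x') => z <-; rewrite !hmapE; apply/hclass_eq0.
  by exists 0; rewrite ?linear0 /= ?gf0//; have [] := @grade_closed _ C (p + 1).
rewrite hmapE => /hclass_eq0[z2 gz2 dz2]; have [y2 gy2 yz2] := g_surj gz2.
have gdy2 : bd B y2 \in grade p by rewrite -[p](addrK 1); apply: bd_grade.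
have [|x' gx xy] := g_ker (gradeB gy gdy2).
  by rewrite linearB /= -chain_map_bd yz2 dz2 /= subrr.
have dx : bd A x' = 0.
  by apply: f_inj; rewrite -chain_map_bd xy linearB /= bdK dy subrr.
exists (hclass (Cycle (mem_cycle gx dx))); rewrite hmapE.
apply/hclass_eq/asboolP; exists (- y2).
  by rewrite -sub0r gradeB//; have [] := @grade_closed _ B (p + 1).
by rewrite linearB /= xy linearN /= addrC addKr.
Qed.

Lemma exact_right p : exact_at (hmap g (p := p)) (@delta_fun p).
Proof.
move=> x; case: (hclass_surj x) => z <-; have [gz dz] := cycleP z; split.
  have [w zw] := connecting_total z; rewrite (delta_funE zw).
  case: zw => y [gy yz yw] /hclass_eq0; rewrite subrK => -[x' gx' dx'].
  have dy : bd B (y - f x') = 0 by rewrite linearB /= chain_map_bd dx' yw subrr.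
  exists (hclass (Cycle (mem_cycle (gradeB gy (chain_map_grade f gx')) dy))).
  rewrite hmapE; congr hclass; apply: val_inj.
  by rewrite /= linearB /= gf0 subr0.
move=> [x'] <-; case: (hclass_surj x') => y <-; have [gy dy] := cycleP y.
rewrite hmapE (delta_funE (w := 0)) ?linear0//.
by exists (\val y); split; rewrite // ?dy /= linear0.
Qed.

Lemma exact_left p : exact_at (@delta_fun p) (hmap f (p := p - 1)).
Proof.
move=> x; case: (hclass_surj x) => w <-; have [gw dw] := cycleP w; split.
  rewrite hmapE => /hclass_eq0; rewrite subrK => -[y gy dy].
  have dz : bd C (g y) = 0 by rewrite chain_map_bd dy gf0.
  exists (hclass (Cycle (mem_cycle (chain_map_grade g gy) dz))).
  by apply: delta_funE; exists y.
move=> [x'] <-; case: (hclass_surj x') => z <-.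
have [w' zw'] := connecting_total z; rewrite (delta_funE zw') hmapE.
apply/hclass_eq0; rewrite subrK.
by case: zw' => y [gy _ yw]; exists y.
Qed.

Lemma long_exact_sequence :
  exists delta : forall p : int, {linear homology C p -> homology A (p - 1)},
  forall p : int, [/\ exact_at (hmap f (p := p)) (hmap g (p := p)),
    exact_at (hmap g (p := p)) (delta p) &
    exact_at (delta p) (hmap f (p := p - 1))].
Proof.
exists (fun p => (@delta_fun p : {linear _ -> _})) => p.
split; [exact: exact_middle | exact: exact_right | exact: exact_left].
Qed.

End LongExactSequence.

(** * Orders in q and infinite sums of long series *)

Section Valuation.
Variable R : realType.
Local Notation LS := (long_series R).
Implicit Types (f g : LS) (x : nat -> LS).

Definition vge (c : R) f : Prop := forall y, coef f y != 0 -> c <= y.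

Lemma coefD f g y : coef (f + g) y = coef f y + coef g y.
Proof. by []. Qed.

Lemma coefN f y : coef (- f) y = - coef f y.
Proof. by []. Qed.

Lemma coef_sum (I : Type) (r : seq I) (P : pred I) (F : I -> LS) y :
  coef (\sum_(i <- r | P i) F i) y = \sum_(i <- r | P i) coef (F i) y.
Proof. exact: (big_morph (fun f => coef f y)). Qed.

Lemma vge0 c : vge c 0.
Proof. by move=> y /eqP[]. Qed.

Lemma vge_ge0 f : vge 0 f.
Proof. by move=> y fy; have [+ _] := longP f; apply. Qed.

Lemma vge_le c d f : c <= d -> vge d f -> vge c f.
Proof. by move=> cd h y /h; apply: le_trans. Qed.

Lemma vgeN c f : vge c f -> vge c (- f).
Proof. by move=> h y; rewrite coefN oppr_eq0 => /h. Qed.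

Lemma vgeD c f g : vge c f -> vge c g -> vge c (f + g).
Proof.
move=> hf hg y; rewrite coefD; have [->|/hf//] := eqVneq (coef f y) 0.
by rewrite add0r => /hg.
Qed.

Lemma vgeB c f g : vge c f -> vge c g -> vge c (f - g).
Proof. by move=> hf hg; apply/vgeD/vgeN. Qed.

Lemma vgeM c d f g : vge c f -> vge d g -> vge (c + d) (f * g).
Proof.
move=> hf hg y fgy; have [a [b [fa gb ->]]] := supp_conv fgy.
by apply: lerD; [exact: hf|exact: hg].
Qed.

Lemma vge_mull c f g : vge c g -> vge c (f * g).
Proof. by move=> hg; rewrite -[c]add0r; apply/vgeM/hg/vge_ge0. Qed.

Lemma vge_qpow c d f : c <= d -> vge c (qpow d * f).
Proof.
move=> cd; rewrite -[c]addr0; apply/vgeM/vge_ge0 => y; rewrite coef_qpow.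
by case: (altP (y =P d)) => [->//|]; rewrite andbF eqxx.
Qed.

Lemma qpowM (a b : R) f : 0 <= a -> 0 <= b ->
  qpow a * (qpow b * f) = qpow (a + b) * f.
Proof. by move=> a0 b0; rewrite qpowD// mulrA. Qed.

(** A nonzero coefficient at [y] contradicts the bound as soon as [n > y + C]. The slack [C] absorbs
    shifts of indices. *)
Lemma vge_eq0 (C : R) f : (forall n : nat, vge (n%:R - C) f) -> f = 0.
Proof.
move=> h; apply: long_eqP => y; apply/eqP; rewrite -[_ == _]negbK;
  apply/negP => fy.
have fy0 : coef f y != 0 by [].
by have := h (Num.truncn (y + C)).+1 y fy0; have := truncnS_gt (y + C); lra.
Qed.

(** If [i >= N y] then [i - 1 >= truncn y + 1 > y], so a term of order at least [i - 1] has no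
    coefficient at [y]. *)
Let N (y : R) := (Num.truncn y).+2.

Lemma wo_supp_ltn x n :
  well_ordered [set y | exists2 i, (i < n)%N & supp (coef (x i)) y]%classic.
Proof.
elim: n => [|n IH]; first by move=> B sB [y /sB[]].
have [_ wn] := longP (x n); apply: wo_sub (wo_setU IH wn) => y [i].
rewrite ltnS leq_eqVlt => /predU1P[->|lt] sy; first by right.
by left; exists i.
Qed.

Lemma lsum_subproof x :
  long_pred (fun y => \sum_(i < N y) coef (x i) y).
Proof.
have nz y : \sum_(i < N y) coef (x i) y != 0 ->
    exists2 i, (i < N y)%N & supp (coef (x i)) y.
  apply: contra_neqP => h; apply: big1 => i _; apply/eqP.
  by apply: contra_notT h => fy; exists i.
apply/asboolP; split=> [y /nz[i _ sy]|B sB [b Bb]].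
  by have [+ _] := longP (x i); apply.
(* Only exponents at most [b] compete for the minimum. As the cutoff [N] is monotone, they lie in
   the finitely many supports of index below [N b]. *)
have [||m [Bm mb] hm] := @wo_supp_ltn x (N b) (B `&` [set y | y <= b])%classic.
- move=> y [/sB/nz[i iy sy] /= yb]; exists i => //.
  by apply: leq_trans iy _; rewrite !ltnS le_truncn.
- by exists b; split=> /=.
exists m => // y By; have [yb|/ltW] := leP y b; first exact: hm.
exact: le_trans.
Qed.

(* Meaningful only if the [i]-th term has valuation at least [i - 1]; the cutoff
   makes the sum total and additive without any condition. *)
Definition lsum x : LS := LongSeries (lsum_subproof x).

Lemma coef_lsum x y : coef (lsum x) y = \sum_(i < N y) coef (x i) y.
Proof. by []. Qed.

Lemma lsumD x x' : lsum (fun i => x i + x' i) = lsum x + lsum x'.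
Proof.
apply: long_eqP => y; rewrite coefD !coef_lsum -big_split.
by apply: eq_bigr.
Qed.

Lemma eq_lsum x x' : (forall i, x i = x' i) -> lsum x = lsum x'.
Proof. by move=> h; congr lsum; apply/funext. Qed.

Lemma lsum0 : lsum (fun=> 0) = 0.
Proof. by apply: long_eqP => y; rewrite coef_lsum big1. Qed.

Lemma lsumN x : lsum (fun i => - x i) = - lsum x.
Proof. by apply: long_eqP => y; rewrite coefN !coef_lsum -sumrN. Qed.

Lemma lsum_vge c x : (forall i, vge c (x i)) -> vge c (lsum x).
Proof.
move=> h y; apply: contraNP => cy; apply/eqP; rewrite coef_lsum big1// => i _.
by apply/eqP; apply: contra_notT cy => /h.
Qed.

Definition rated x : Prop := forall i, vge (i%:R - 1) (x i).

(** For [0 <= y < n - 1] the cutoff [N y] is at most [n], and the terms of index from [N y] to [n]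
    have too high an order to reach [y]. *)
Lemma lsum_partial x n : rated x -> vge (n%:R - 1) (lsum x - \sum_(i < n) x i).
Proof.
move=> rx y; apply: contraNP => /negP; rewrite -ltNge => yn; apply/eqP.
rewrite coefD coefN coef_lsum coef_sum; have [y0|y0] := ltP y 0.
  have z i : coef (x i) y = 0.
    by apply/eqP; apply/negPn/negP => /(vge_ge0 (f := x i)); rewrite leNgt y0.
  by rewrite !big1 ?subrr.
have Nn : (N y <= n)%N.
  case: n yn => [|m]; first by move: y0; lra.
  by rewrite -addn1 natrD addrK => ym; rewrite /N addn1 ltnS truncn_lt_nat.
rewrite -(big_mkord xpredT (fun i => coef (x i) y)).
rewrite -(big_mkord xpredT (fun i => coef (x i) y)) (big_cat_nat _ Nn) //=.
rewrite opprD addrA subrr sub0r big_nat big1 ?oppr0// => i /andP[Ni _].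
apply/eqP/negPn/negP => /rx; apply/negP; rewrite -ltNge.
have /lt_le_trans : y < (Num.truncn y).+1%:R := truncnS_gt y.
by apply; rewrite lerBrDr natr1 ler_nat.
Qed.

(** Partial sums determine the limit whatever the constant loss [C]. This is how scalars and index
    shifts pass through infinite sums. *)
Lemma lsum_unique x f C : rated x ->
  (forall n, vge (n%:R - C) (f - \sum_(i < n) x i)) -> f = lsum x.
Proof.
move=> rx fx; apply/eqP; rewrite -subr_eq0; apply/eqP.
apply: (vge_eq0 (C := Num.max C 1)) => n.
have -> : f - lsum x = (f - \sum_(i < n) x i) - (lsum x - \sum_(i < n) x i).
  by rewrite opprB addrA subrK.
apply: vgeB.
  by apply: vge_le _ (fx n); rewrite lerB// le_max lexx.
have := lsum_partial (n := n) rx; apply: vge_le.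
by rewrite lerB// le_max lexx orbT.
Qed.

Lemma lsumZ f x : rated x -> lsum (fun i => f * x i) = f * lsum x.
Proof.
move=> rx; apply/esym/(lsum_unique (C := 1)) => [i|n].
  exact: vge_mull.
by rewrite -mulr_sumr -mulrBr; apply: vge_mull; exact: lsum_partial.
Qed.

Lemma lsum_sum (I : finType) (P : pred I) (F : I -> nat -> LS) :
  lsum (fun i => \sum_(u | P u) F u i) = \sum_(u | P u) lsum (F u).
Proof.
apply: long_eqP => y; rewrite coef_lsum coef_sum exchange_big /=.
by apply: eq_bigr => i _; rewrite coef_sum.
Qed.

(** The indices [i + 1] and [- i] are grouped because [j <-> 1 - j] exchanges them and preserves
    [j * (j - 1)]. The cancellation in [theta_of_const] is then termwise. *)
Definition zsum (x : int -> LS) : LS :=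
  lsum (fun i => x i.+1 + x (- i%:Z)).

Definition zrated (x : int -> LS) : Prop := forall j, vge (`|j|%:~R - 1) (x j).

Lemma zrated_rated (x : int -> LS) : zrated x -> rated (fun i =>
  x i.+1 + x (- i%:Z)).
Proof.
move=> rx i; apply: vgeD; apply: vge_le (rx _).
  by rewrite lerB// (ger0_norm (le0z_nat _)) -pmulrn ler_nat.
by rewrite normrN (ger0_norm (le0z_nat _)) -pmulrn.
Qed.

Lemma zsumD (x y : int -> LS) : zsum (fun j => x j + y j) = zsum x + zsum y.
Proof. by rewrite /zsum -lsumD; apply: eq_lsum => i; rewrite addrACA. Qed.

Lemma zsumN (x : int -> LS) : zsum (fun j => - x j) = - zsum x.
Proof. by rewrite /zsum -lsumN; apply: eq_lsum => i; rewrite opprD. Qed.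

Lemma eq_zsum (x y : int -> LS) : x =1 y -> zsum x = zsum y.
Proof. by move=> /funext->. Qed.

Lemma zsum0 : zsum (fun=> 0) = 0.
Proof. by rewrite -[RHS]lsum0; apply: eq_lsum => i; rewrite addr0. Qed.

Lemma zsumZ f (x : int -> LS) : zrated x -> zsum (fun j =>
  f * x j) = f * zsum x.
Proof.
move=> /zrated_rated/(lsumZ f) <-.
by apply: eq_lsum => i; rewrite mulrDr.
Qed.

Lemma zsum_sum (I : finType) (P : pred I) (F : I -> int -> LS) :
  zsum (fun j => \sum_(u | P u) F u j) = \sum_(u | P u) zsum (F u).
Proof. by rewrite -lsum_sum; apply: eq_lsum => i; rewrite big_split. Qed.

(** The partial sums of the two families differ only by [x n.+1] and [x (1 - n)], whose orders tend
    to infinity. The second has order at least [n - 2], whence [C = 2]. *)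
Lemma zsum_shift (x : int -> LS) : zrated x -> zrated (fun j => x (j + 1)) ->
  zsum (fun j => x (j + 1)) = zsum x.
Proof.
move=> rx rx1; apply/esym/(lsum_unique (C := 2)) => [|n].
  exact: (zrated_rated rx1).
have -> : \sum_(i < n) (x (i.+1%:Z + 1) + x (- i%:Z + 1)) =
    \sum_(i < n) (x i.+1 + x (- i%:Z)) + x n.+1 - x (1 - n%:Z).
  elim: n => [|n IH]; first by rewrite !big_ord0 add0r subrr.
  rewrite !big_ord_recr /= {}IH; set s := \sum_(_ < _) _.
  rewrite (_ : 1 - n.+1%:Z = - n%:Z); last by rewrite -addn1 PoszD; ring.
  rewrite (_ : n.+1%:Z + 1 = n.+2%:Z); last by rewrite -[n.+2]addn1 PoszD.
  by rewrite [- n%:Z + 1]addrC; ring.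
set s := \sum_(_ < _) _.
have -> : zsum x - (s + x n.+1 - x (1 - n%:Z)) =
  (zsum x - s) - x n.+1 + x (1 - n%:Z) by ring.
apply: vgeD; first apply: vgeB.
- apply: vge_le (lsum_partial (n := n) (zrated_rated rx)); lra.
- apply: vge_le (rx _); rewrite (ger0_norm (le0z_nat _)) -pmulrn.
  by rewrite -addn1 natrD; lra.
- apply: vge_le (rx _); rewrite (_ : n%:R - 2 = (n%:Z - 1)%:~R - 1 :> R).
    by rewrite lerB// ler_int distrC ler_norm.
  by rewrite intrB; ring.
Qed.

(** * Two-sided recursions perturbed by a contraction *)

Section TwoSided.
Variable Q : (int -> LS) -> int -> LS.
Hypothesis Q_contract : forall (n : nat) u v, (forall k,
  vge n%:R (u k - v k)) ->
  forall k, vge n.+1%:R (Q u k - Q v k).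
Variables a b : nat -> LS.

(** The weights [a n] and [b n] may have order 0, so their terms cannot be left to the contraction.
    For a fixed inhomogeneous term [y] the recursion is solved exactly, outwards from 0, and a
    solution of the full system is a fixed point of [solve] after [Q]. *)
Let right (y : int -> LS) : nat -> LS :=
  fix r n := if n is m.+1 then y n + a m * r m else y 0.
Let left (y : int -> LS) : nat -> LS :=
  fix l n := if n is m.+1 then y (- n%:Z) + b m * l m else y 0.
Let solve (y : int -> LS) (k : int) : LS :=
  match k with Posz n => right y n | Negz n => left y n.+1 end.

Let left_solve y n : left y n = solve y (- n%:Z).
Proof. by case: n. Qed.

Lemma solve_vge c u v : (forall k, vge c (u k - v k)) ->
  forall k, vge c (solve u k - solve v k).
Proof.
move=> uv.
have step (z z' w w' e : LS) : vge c (z - z') -> vge c (w - w') ->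
    vge c (z + e * w - (z' + e * w')).
  move=> h1 h2; have -> : z + e * w - (z' + e * w') =
    (z - z') + e * (w - w') by ring.
  by apply: vgeD => //; apply: vge_mull.
have hr n : vge c (right u n - right v n) by elim: n => [|n IH] //=;
  apply: step.
have hl n : vge c (left u n - left v n) by elim: n => [|n IH] //=; apply: step.
by case=> n; [exact: hr|exact: hl].
Qed.

Definition two_sided (c : int -> LS) : Prop :=
  [/\ c 0 = Q c 0, forall n : nat, c n.+1 = Q c n.+1 + a n * c n &
      forall n : nat, c (- n.+1%:Z) = Q c (- n.+1%:Z) + b n * c (- n%:Z)].

Lemma two_sidedE c : two_sided c <-> c = solve (Q c).
Proof.
split=> [[c0 cr cl]|cE]; last first.
  have hr (n : nat) : c n = right (Q c) n by rewrite {1}cE.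
  have hl (n : nat) : c (- n%:Z) = left (Q c) n by rewrite {1}cE left_solve.
  split=> [|n|n]; [by rewrite (hr 0%N)|by rewrite !hr|by rewrite !hl].
have hr (n : nat) : c n = right (Q c) n by elim: n => [|n IH] //=;
  rewrite cr IH.
have hl (n : nat) : c (- n%:Z) = left (Q c) n.
  by elim: n => [|n IH]; rewrite ?oppr0// cl IH.
by apply/funext => -[] n; [exact: hr|rewrite NegzE; exact: hl].
Qed.

Lemma two_sided_unique c c' : two_sided c -> two_sided c' -> c = c'.
Proof.
move=> /two_sidedE cE /two_sidedE cE'.
suff h (n : nat) : forall k, vge n%:R (c k - c' k).
  apply/funext => k; apply/eqP; rewrite -subr_eq0; apply/eqP.
  by apply: (vge_eq0 (C := 0)) => n; rewrite subr0.
elim: n => [|n IH] k; first exact: vge_ge0.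
by rewrite cE cE'; apply/solve_vge/Q_contract.
Qed.

Lemma two_sided_exists : exists c, two_sided c.
Proof.
pose F c := solve (Q c).
pose u n := iter n F (fun=> 0).
have u1 (n : nat) : forall k, vge n%:R (u n.+1 k - u n k).
  elim: n => [|n IH] k; first exact: vge_ge0.
  exact/solve_vge/Q_contract.
(* The limit of the fixed-point iteration started at 0, written as a telescoping series so that
   [lsum] applies. *)
pose c k := lsum (fun n => u n.+1 k - u n k).
have rk k : rated (fun n => u n.+1 k - u n k).
  by move=> n; apply: vge_le (u1 n k); rewrite gerBl.
have cu (n : nat) : forall k, vge n%:R (c k - u n k).
  move=> k; have := lsum_partial (n := n.+1) (rk k).
  rewrite -(big_mkord xpredT (fun i => u i.+1 k - u i k)) telescope_sumr//.
  have h : vge n%:R (u n.+1 k - u n k) := u1 n k.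
  rewrite -natr1 addrK subr0 => h'.
  by have := vgeD h' h; rewrite addrA subrK.
exists c; apply/two_sidedE/funext => k.
apply/eqP; rewrite -subr_eq0; apply/eqP; apply: (vge_eq0 (C := 0)) => n.
rewrite subr0 (_ : _ - _ = (c k - u n.+1 k) - (F c k - F (u n) k));
  last by rewrite opprB addrA subrK.
apply: vgeB; apply: (vge_le (d := n.+1%:R)); rewrite ?ler_nat//.
exact/solve_vge/Q_contract.
Qed.

End TwoSided.

Lemma zsum_vge c (x : int -> LS) : (forall j, vge c (x j)) -> vge c (zsum x).
Proof. by move=> h; apply: lsum_vge => i; apply: vgeD. Qed.

Lemma zsum3 (x : int -> LS) :
  (forall j, (1 < `|j|)%N -> x j = 0) -> zsum x = x 1 + x 0 + x (- 1).
Proof.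
move=> x0; apply: long_eqP => y; rewrite coef_lsum !big_ord_recl big1 /=.
  by rewrite oppr0 (x0 2) // add0r addr0.
by move=> i _; rewrite !x0 // addr0.
Qed.

(** * Theta-like sums along a line *)

Section Theta.
Variable H : int -> R.
Hypothesis H_slope : forall k, 0 <= H (k + 1) - H k <= 2.

(* The slope condition makes these exponents nonnegative and quadratic in [j]. *)
Definition theta_exp (k j : int) : R := H k - H (k - j) + (j * (j - 1))%:~R.

(** The map psi on one line, read on coefficients: the target at position [k] collects the sources
    at positions [k - j]. *)
Definition theta (c : int -> LS) (k : int) : LS :=
  zsum (fun j => qpow (theta_exp k j) * c (k - j)).

Lemma H_slopes k (n : nat) : 0 <= H (k + n%:Z) - H k <= 2 * n%:R.
Proof.
elim: n => [|n IH]; first by rewrite addr0 subrr mulr0 lexx.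
have := H_slope (k + n%:Z); rewrite -addrA -(PoszD n 1) addn1 -[n.+1 in X in _
  -> X]addn1.
by rewrite natrD addn1; move: IH; lra.
Qed.

(** For [j >= 0] monotonicity of [H] suffices. For [j = - n] the slope bound 2 loses at most
    [2 * n], and [j * (j - 1) = n * (n - 1) + 2 * n] makes up for it. *)
Lemma theta_exp_ge k j : (`|j| * (`|j| - 1))%:~R <= theta_exp k j.
Proof.
rewrite /theta_exp; case: j => n.
  rewrite (ger0_norm (le0z_nat _)) lerDr.
  by have := H_slopes (k - n%:Z) n; rewrite subrK => /andP[].
rewrite NegzE normrN (ger0_norm (le0z_nat _)) opprK.
have /andP[_] := H_slopes k n.+1.
have -> : - n.+1%:Z * (- n.+1%:Z - 1) = n.+1%:Z * (n.+1%:Z - 1) + n.+1%:Z * 2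
  by ring.
rewrite intrD [X in _ <= _ + (_ + X)]intrM -pmulrn; lra.
Qed.

Lemma theta_exp_ge0 k j : 0 <= theta_exp k j.
Proof.
apply: le_trans (theta_exp_ge k j); rewrite ler0z;
  move: `|j| (normr_ge0 j) => m; nia.
Qed.

Lemma theta_rated c k : zrated (fun j => qpow (theta_exp k j) * c (k - j)).
Proof.
move=> j; apply: vge_qpow; apply: le_trans (theta_exp_ge k j).
rewrite -[1]/(1%:~R) -intrB ler_int; move: `|j| (normr_ge0 j) => m; nia.
Qed.

Lemma theta_linear f c c' k :
  theta (fun l => f * c l + c' l) k = f * theta c k + theta c' k.
Proof.
rewrite /theta -zsumZ; last exact: theta_rated.
rewrite -zsumD.
by apply: eq_zsum => j; rewrite mulrDr mulrCA.
Qed.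

(** Selects the terms whose exponent may be below 1; the others form the contracting part. *)
Variable main : int -> pred int.
Hypothesis main_small : forall k j, (1 < `|j|)%N -> main k j = false.
Hypothesis main_rest : forall k j, ~~ main k j -> 1 <= theta_exp k j.

Definition theta_main c k j := if main k j then qpow (theta_exp k j) * c (k -
  j) else 0.

Definition theta_rest (c : int -> LS) k :=
  zsum (fun j => if main k j then 0 else qpow (theta_exp k j) * c (k - j)).

Lemma theta_split c k : theta c k =
  theta_main c k 1 + theta_main c k 0 + theta_main c k (- 1) + theta_rest c k.
Proof.
rewrite -zsum3 => [|j j1]; last by rewrite /theta_main main_small.
rewrite -zsumD; apply: eq_zsum => j.
by rewrite /theta_main; case: ifP; rewrite ?addr0 ?add0r.
Qed.

Lemma theta_rest_vge (n : nat) u v : (forall k, vge n%:R (u k - v k)) ->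
  forall k, vge n.+1%:R (theta_rest u k - theta_rest v k).
Proof.
move=> uv k; rewrite /theta_rest -zsumN -zsumD; apply: zsum_vge => j.
case: ifPn => mj; first by rewrite subrr; apply: vge0.
rewrite -mulrBr -natr1 addrC; apply: vgeM => //.
by rewrite -[qpow _]mulr1; apply/vge_qpow/main_rest.
Qed.

End Theta.

(** * Bijectivity of theta when the slope crosses 1 at position 0 *)

Section Bijective.
Variable H : int -> R.
Hypothesis H_slope : forall k, 0 <= H (k + 1) - H k <= 2.
Hypothesis H_right : forall k, 0 <= k -> H (k + 1) - H k <= 1.
Hypothesis H_left : forall k, k < 0 -> 1 <= H (k + 1) - H k.

(** Besides [j = 0] only the neighbour one step nearer to 0 is kept. The other neighbour has
    exponent at least 1: for [j = 1] it is a slope to the left of 0, and for [j = -1] it is 2 minus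
    a slope to the right. *)
Let main (k j : int) : bool :=
  [|| j == 0, (j == 1) && (0 < k) | (j == -1) && (k < 0)].

Let main_small k j : (1 < `|j|)%N -> main k j = false.
Proof. by rewrite /main; lia. Qed.

Let main_rest k j : ~~ main k j -> 1 <= theta_exp H k j.
Proof.
rewrite /main; have [j1|j1] := leqP 2 `|j|%N.
  move=> _; apply: le_trans (theta_exp_ge H_slope k j).
  by rewrite ler1z; move: j1; nia.
have [->|->|->//] : [\/ j = 1, j = -1 | j = 0].
- by move: j1; case: j => [[|[|]]|[|]] // _; [constructor 3|constructor
  1|constructor 2].
- move=> k0; have k1 : k - 1 < 0 by lia.
  by have := H_left k1; rewrite /theta_exp subrK /= mulr0 addr0.
- move=> k0; have k1 : 0 <= k by lia.
  by have := H_right k1; rewrite /theta_exp opprK mulN1r opprB opprK; lra.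
Qed.

(** The term [j = 0] has exponent 0, so the equation at [k] can be solved for [c k] in terms of the
    neighbour nearer to 0 and the contracting rest. *)
Lemma theta_two_sided y c : (forall k, theta H c k = y k) <->
  two_sided (fun c k => y k - theta_rest H main c k)
    (fun n => - qpow (theta_exp H n.+1 1)) (fun n =>
      - qpow (theta_exp H (- n.+1%:Z) (-1))) c.
Proof.
have e0 k : theta_exp H k 0 = 0 by rewrite /theta_exp subr0 subrr mul0r addr0.
have t0 : theta H c 0 = c 0 + theta_rest H main c 0.
  rewrite (theta_split H main_small) /theta_main /= e0 mul1r.
  by rewrite subrr add0r addr0.
have tr (n : nat) : theta H c n.+1 =
    c n.+1 + qpow (theta_exp H n.+1 1) * c n + theta_rest H main c n.+1.
  rewrite (theta_split H main_small) /theta_main /= e0 mul1r subr0 addr0.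
  by rewrite (_ : n.+1%:Z - 1 = n) ?[c _ + _]addrC//; lia.
have tl (n : nat) : theta H c (- n.+1%:Z) =
    c (- n.+1%:Z) + qpow (theta_exp H (- n.+1%:Z) (-1)) * c (- n%:Z) +
      theta_rest H main c (- n.+1%:Z).
  rewrite (theta_split H main_small) /theta_main /= e0 mul1r subr0 add0r.
  by rewrite (_ : - n.+1%:Z - -1 = - n%:Z) //; lia.
split=> [ty|[c0 cr cl] k].
  split=> [|n|n]; rewrite -ty ?t0 ?tr ?tl; ring.
case: k => [[|n]|n]; rewrite ?NegzE.
- by rewrite t0 c0 subrK.
- by rewrite tr cr; ring.
- by rewrite tl cl; ring.
Qed.

Let contract y n u v : (forall k, vge n%:R (u k - v k)) ->
  forall k, vge n.+1%:R (y k - theta_rest H main u k - (y k - theta_rest H main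
    v k)).
Proof.
move=> uv k; rewrite opprB addrC subrKA -opprB; apply: vgeN.
exact: theta_rest_vge.
Qed.

Lemma theta_inj c c' : (forall k, theta H c k = theta H c' k) -> c = c'.
Proof.
move=> /theta_two_sided h.
have /theta_two_sided h' : forall k, theta H c' k = theta H c' k by [].
exact: (two_sided_unique (@contract _) h h').
Qed.

Lemma theta_surj y : exists c, forall k, theta H c k = y k.
Proof.
have [c hc] := two_sided_exists (@contract y) (fun n =>
  - qpow (theta_exp H n.+1 1))
  (fun n => - qpow (theta_exp H (- n.+1%:Z) (-1))).
by exists c; apply/theta_two_sided.
Qed.

End Bijective.

(** * Surjectivity and kernel of theta when [H] is constant *)

Section Constant.
Variable H : int -> R.
Hypothesis H_const : forall k, H k = H 0.

Let main (k j : int) : bool := (j == 0) || (j == 1).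

Let main_small k j : (1 < `|j|)%N -> main k j = false.
Proof. by rewrite /main; lia. Qed.

Let H_slope k : 0 <= H (k + 1) - H k <= 2.
Proof. by rewrite !(H_const (_ + _)) H_const subrr lexx ler0n. Qed.

Let expE k j : theta_exp H k j = (j * (j - 1))%:~R.
Proof. by rewrite /theta_exp H_const [H (k - j)]H_const subrr add0r. Qed.

Let main_rest k j : ~~ main k j -> 1 <= theta_exp H k j.
Proof. by rewrite expE /main ler1z => h; nia. Qed.

(** The equation at [k] ties [c k] to [c (k - 1)] with unit coefficients. The value [e] at 0 is thus
    free, and to the left of 0 the unknown [c k] comes from the equation at [k + 1]. *)
Let Q e y (c : int -> LS) (k : int) : LS :=
  if k == 0 then e else if 0 < k then y k - theta_rest H main c k
  else y (k + 1) - theta_rest H main c (k + 1).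

Let contract e y n u v : (forall k, vge n%:R (u k - v k)) ->
  forall k, vge n.+1%:R (Q e y u k - Q e y v k).
Proof.
move=> uv k; have h l : vge n.+1%:R (y l - theta_rest H main u l - (y l -
  theta_rest H main v l)).
  by rewrite opprB addrC subrKA -opprB; apply: vgeN; apply: theta_rest_vge.
by rewrite /Q; case: ifP => _; [rewrite subrr; exact: vge0|case: ifP].
Qed.

Lemma theta_const_two_sided e y c : (c 0 = e /\ forall k, theta H c k = y k) <->
  two_sided (Q e y) (fun=> -1) (fun=> -1) c.
Proof.
have tE k : theta H c k = c k + c (k - 1) + theta_rest H main c k.
  rewrite (theta_split H main_small) /theta_main /= !expE !mul1r subr0 addr0.
  by rewrite [c _ + _]addrC.
split=> [[c0 ty]|[c0 cr cl]].
  split=> [//|n|n]; rewrite /Q /= -ty tE.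
    by rewrite (_ : n.+1%:Z - 1 = n); [ring|lia].
  by rewrite (_ : - n.+1%:Z + 1 = - n%:Z); [rewrite (_ : - n%:Z - 1 =
    - n.+1%:Z); [ring|lia]|lia].
split=> // k; rewrite tE; case: (ltP 0 k) => k0.
  have [n ->] : exists n : nat, k = n.+1 by exists `|k|%N.-1; lia.
  rewrite cr (_ : n.+1%:Z - 1 = n); last lia.
  by rewrite /Q /=; ring.
have [n ->] : exists n : nat, k = - n%:Z by exists `|k|%N; lia.
rewrite (_ : - n%:Z - 1 = - n.+1%:Z); last lia.
rewrite cl /Q /= (_ : - n.+1%:Z + 1 = - n%:Z); last lia.
ring.
Qed.

Lemma theta_const_surj y : exists c, forall k, theta H c k = y k.
Proof.
have [c /theta_const_two_sided[_ hc]] := two_sided_exists (@contract 0 y)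
  (fun=> -1) (fun=> -1).
by exists c.
Qed.

(** The exponents at [j] and [1 - j] coincide, so the paired terms of [zsum] cancel in
    characteristic 2. *)
Lemma theta_of_const e k : theta H (fun=> e) k = 0.
Proof.
rewrite -lsum0; apply: eq_lsum => i; rewrite !expE.
rewrite (_ : - i%:Z * (- i%:Z - 1) = i.+1%:Z * (i.+1%:Z - 1)) ?long_addrr//;
  lia.
Qed.

(** [c] and the constant family of value [c 0] solve the same recursion, whose solution is
    unique. *)
Lemma theta_const_ker c : (forall k, theta H c k = 0) -> c = fun=> c 0.
Proof.
move=> h; apply: (@two_sided_unique _ (@contract (c 0) (fun=> 0)) (fun=> -1)
  (fun=> -1)).
  exact/theta_const_two_sided.
by apply/theta_const_two_sided; split=> // k; exact: theta_of_const.
Qed.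

End Constant.

(** [m] is the first position from [a] on where [D] is at most 1; monotonicity gives both halves. *)
Lemma exists_center (D : int -> R) : (forall k, D (k + 1) <= D k) ->
  (exists k, D k <= 1) -> (exists k, 1 < D k) ->
  exists m, (forall k, m <= k -> D k <= 1) /\ (forall k, k < m -> 1 <= D k).
Proof.
move=> anti [b Db] [a Da].
have antiD k (n : nat) : D (k + n%:Z) <= D k.
  elim: n => [|n IH]; first by rewrite addr0.
  by apply: le_trans IH; rewrite -addn1 PoszD addrA.
have le_D k l : k <= l -> D l <= D k.
  by move=> kl; have := antiD k `|l - k|%N; rewrite (_ : k + _ = l)//; lia.
have ab : a <= b by rewrite leNgt; apply/negP => /ltW/le_D; lra.
have ex : exists n : nat, D (a + n%:Z) <= 1.
  by exists `|b - a|%N; rewrite (_ : a + _ = b)//; lia.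
case: (ex_minnP ex) => n Dn minn; exists (a + n%:Z); split=> k nk.
  exact: le_trans (le_D _ _ nk) Dn.
have [/le_D|ak] := leP k a; first lra.
rewrite leNgt; apply/negP => Dk.
have := minn `|k - a|%N; rewrite (_ : a + _ = k); last lia.
by move=> /(_ (ltW Dk)); lia.
Qed.

Lemma theta_translate (H : int -> R) c m k :
  theta (fun l => H (l + m)) (fun l => c (l + m)) k = theta H c (k + m).
Proof.
by apply: eq_zsum => j; rewrite /theta_exp [k + m - j]addrAC.
Qed.

End Valuation.

(** * Characteristic classes tested on vertices *)

Section Characteristic.
Variable Gamma : marked_graph.
Local Notation V := (vertex Gamma).
Implicit Types (K : coH2 Gamma) (x y : H2 Gamma) (I : {set V}).

Lemma form0l x : form (Gamma := Gamma) 0 x = 0.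
Proof. by rewrite /form big1// => u _; rewrite big1// => w _;
  rewrite ffunE !mul0r. Qed.

Lemma ev0 K : ev K (0 : H2 Gamma) = 0.
Proof. by rewrite /ev big1// => u _; rewrite ffunE mulr0. Qed.

Lemma H2_ind (P : H2 Gamma -> Prop) : P 0 -> (forall x y, P x -> P y ->
  P (x + y)) ->
  (forall x, P x -> P (- x)) -> (forall u, P (vtx u)) -> forall x, P x.
Proof.
move=> P0 PD PN Pu x.
have -> : x = \sum_u vtx u *~ x u.
  apply/ffunP => w; rewrite sum_ffunE (bigD1 w) //= big1 ?addr0 => [|u uw].
    by rewrite ffunMzE mulrzz ffunE eqxx mul1r.
  by rewrite ffunMzE mulrzz ffunE eq_sym (negbTE uw) mul0r.
apply: (big_ind P) => // u _.
have PM n : P (vtx u *+ n) by elim: n => [|n IH]; rewrite ?mulr0n// mulrS;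
  apply: PD.
by case: (x u) => n; [rewrite -pmulrn|rewrite NegzE mulrNz -pmulrn; apply: PN].
Qed.

(** Modulo 2 the difference [ev K x - form x x] is additive in [x], the cross term being
    [2 * form x y], so a basis suffices. *)
Lemma char_predP K :
  reflect (forall u, (2 %| K u - weight Gamma u)%Z) (char_pred K).
Proof.
apply: (iffP (asboolP _)) => [h u|h].
  rewrite -eqz_mod_dvd; apply/eqP; have := h (vtx u).
  by rewrite ev_vtx form_vtx /vdot eqxx.
suff hx x : (2 %| ev K x - form x x)%Z.
  by move=> x; apply/eqP; rewrite eqz_mod_dvd.
elim/H2_ind: x => [|x y hx hy|x hx|u].
- by rewrite ev0 form0l subr0 dvdz0.
- rewrite evDr !formDl !formDr (formC y x).
  have -> : ev K x + ev K y - (form x x + form x y + (form x y + form y y)) =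
    (ev K x - form x x) + (ev K y - form y y) - 2 * form x y by ring.
  by apply: rpredB; [exact: rpredD|exact: dvdz_mulr].
- have -> : form (- x) (- x) = form x x.
    by apply: eq_bigr => u _; apply: eq_bigr => w _; rewrite !ffunE mulrNN.
  have -> : ev K (- x) = - ev K x.
    by rewrite /ev -sumrN; apply: eq_bigr => u _; rewrite ffunE mulrN.
  have -> : - ev K x - form x x = - (ev K x - form x x) - 2 * form x x by ring.
  by apply: rpredB; [rewrite rpredN|exact: dvdz_mulr].
- by rewrite ev_vtx form_vtx /vdot eqxx.
Qed.

Lemma ev_vset K I : ev K (vset I) = \sum_(u in I) K u.
Proof.
rewrite (big_morph (ev K) (evDr K) (ev0 K)).
by apply: eq_bigr => u _; rewrite ev_vtx.
Qed.

Lemma form_vset I : form (vset I) (vset I) = \sum_(u in I) \sum_(w in I) vdot u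
  w.
Proof.
have fDl (z : H2 Gamma) : {morph (fun x => form x z) : x y / x + y} by move=> x
  y; apply: formDl.
have fDr (z : H2 Gamma) : {morph (form z) : x y / x + y} by move=> x y;
  apply: formDr.
rewrite {1}/vset (big_morph _ (fDl _) (form0l _)); apply: eq_bigr => u _.
rewrite (big_morph _ (fDr _) (_ : form _ (0 : H2 Gamma) = 0));
  last by rewrite formC form0l.
by apply: eq_bigr => w _; rewrite form_vtx.
Qed.

End Characteristic.

(** * The weight minima as functions along a line *)

Section Weights.
Variables (R : realType) (Gamma : marked_graph) (t : R).
Hypothesis t02 : 0 <= t <= 2.
Local Notation V := (vertex Gamma).
Implicit Types (K : Char Gamma) (E I : {set V}) (u w v : V).

Lemma half_weight_vset K I : half_weight R K (vset I) =
  (\sum_(u in I) val K u + \sum_(u in I) \sum_(w in I) vdot u w)%:~R / 2.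
Proof. by rewrite /half_weight ev_vset form_vset. Qed.

Lemma vset1 u : vset [set u]%SET = vtx u.
Proof. by rewrite /vset big_set1. Qed.

(** The function [G] of the overview. The exponents of the differential are its differences,
    corrected by [tweight] for the second kind. *)
Definition tmin K E : R :=
  (2 - t) * gmin R K E + t * gmin R (shift K (dual0 Gamma)) E.

Definition tweight K u : R :=
  (2 - t) * half_weight R K (vtx u) +
  t * half_weight R (shift K (dual0 Gamma)) (vtx u).

Lemma at_expE K E u : at_exp t K E u = tmin K (E :\ u) - tmin K E.
Proof. by rewrite /at_exp /a_exp /tmin; ring. Qed.

Lemma bt_expE K E u :
  bt_exp t K E u = tmin (shift K (dual u)) (E :\ u) - tmin K E + tweight K u.
Proof. by rewrite /bt_exp /b_exp /tmin /tweight (shiftAC _ (dual u)); ring. Qed.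

(** The class [d] of the overview: a dual basis element, not the class [dual v] that pairs by
    intersection with [v]. *)
Definition cobasis v : coH2 Gamma := [ffun w => (w == v)%:Z].

Lemma cobasisz v (k : int) w : (cobasis v *~ k) w = if w == v then k else 0.
Proof. by rewrite ffunMzE mulrzz ffunE; case: eqP; rewrite ?mul1r ?mul0r. Qed.

Lemma sum_cobasis v k I : \sum_(u in I) (cobasis v *~ k) u =
  if v \in I then k else 0.
Proof.
rewrite (eq_bigr (fun u => if u == v then k else 0)) => [|u _];
  last exact: cobasisz.
rewrite -big_mkcondr /=; case: ifP => vI.
  by rewrite (big_pred1 v)// => u /=; case: eqP => [->|]; rewrite ?vI ?andbF.
by rewrite big_pred0// => u /=; case: eqP => [->|]; rewrite ?vI ?andbF.
Qed.

Lemma half_weight_cobasis K v k I : half_weight R (shift K (cobasis v *~ k))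
  (vset I) =
  half_weight R K (vset I) + if v \in I then k%:~R else 0.
Proof.
rewrite !half_weight_vset.
have -> : \sum_(u in I) val (shift K (cobasis v *~ k)) u =
    \sum_(u in I) val K u + 2 * if v \in I then k else 0.
  rewrite -sum_cobasis.
  rewrite mulr_sumr -big_split; apply: eq_bigr => u _.
  by rewrite val_shift ffunE ffunMnE mulr_natl.
by rewrite -addrA [2 * _ + _]addrC addrA intrD mulrDl; case: ifP => _;
  rewrite ?intrM; field.
Qed.

(** Each competitor [I] in the minimum grows by 1 or 0, according to whether it contains [v]. *)
Lemma gmin_cobasis_le K v E :
  0 <= gmin R (shift K (cobasis v)) E - gmin R K E <= 1.
Proof.
have hb I : half_weight R (shift K (cobasis v)) (vset I) =
    half_weight R K (vset I) + if v \in I then 1 else 0.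
  by have := half_weight_cobasis K v 1 I; rewrite mulr1z.
apply/andP; split.
  rewrite subr_ge0; apply: gmin_ge => I IE; apply: le_trans (gmin_le R K IE) _.
  by rewrite hb; case: ifP; rewrite ?addr0 ?lerDl.
rewrite lerBlDr -lerBlDl; apply: gmin_ge => I IE.
rewrite lerBlDl; apply: le_trans (gmin_le R _ IE) _.
by rewrite hb addrC lerD2r; case: ifP.
Qed.

Lemma gmin_cobasis_notin K v E (k : int) : v \notin E ->
  gmin R (shift K (cobasis v *~ k)) E = gmin R K E.
Proof.
move=> vE; apply: eq_bigr => I IE; rewrite half_weight_cobasis.
by case: ifP => [/(fintype.subsetP IE)|]; rewrite ?(negbTE vE)// addr0.
Qed.

(** A minimum of functions that are affine along the line is concave. *)
Lemma gmin_cobasis_concave K v E :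
  gmin R (shift K (cobasis v)) E + gmin R (shift K (- cobasis v)) E <= 2 * gmin
    R K E.
Proof.
rewrite -ler_pdivrMl//; apply: gmin_ge => I IE; rewrite ler_pdivrMl//.
have := gmin_le R (shift K (cobasis v)) IE; have :=
  gmin_le R (shift K (- cobasis v)) IE.
have := half_weight_cobasis K v (-1) I; rewrite mulrN1z => ->.
by have := half_weight_cobasis K v 1 I; rewrite mulr1z => ->; case: ifP => _;
  lra.
Qed.

Lemma gmin_cobasis_upper K v E (k : int) : v \in E ->
  gmin R (shift K (cobasis v *~ k)) E <= half_weight R K (vtx v) + k%:~R.
Proof.
move=> vE; have h : [set v]%SET \subset E by rewrite finset.sub1set.
apply: le_trans (gmin_le R _ h) _.
by rewrite half_weight_cobasis finset.set11 vset1.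
Qed.

Lemma gmin_le0 K E : gmin R K E <= 0.
Proof. by rewrite -(half_weight0 R K) gmin_le ?finset.sub0set. Qed.

Definition line K v E (k : int) : R := tmin (shift K (cobasis v *~ k)) E.

Lemma shift_cobasisD K v (k l : int) :
  shift (shift K (cobasis v *~ k)) (cobasis v *~ l) =
    shift K (cobasis v *~ (k + l)).
Proof. by rewrite shift_shift mulrzDr. Qed.

Lemma tmin_cobasis_slope K v E : 0 <= tmin (shift K (cobasis v)) E - tmin K E
  <= 2.
Proof.
have := gmin_cobasis_le K v E; have := gmin_cobasis_le (shift K (dual0 Gamma))
  v E.
rewrite /tmin (shiftAC _ (cobasis v)) => /andP[h1 h2] /andP[h3 h4].
have /andP[t0 t2] := t02; apply/andP; split; nra.
Qed.

Lemma line_slope K v E k : 0 <= line K v E (k + 1) - line K v E k <= 2.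
Proof. by rewrite /line -shift_cobasisD mulr1z; apply: tmin_cobasis_slope. Qed.

Lemma line_const K v E k : v \notin E -> line K v E k = line K v E 0.
Proof.
by move=> vE; rewrite /line /tmin !(shiftAC _ (cobasis v *~ _))
  !gmin_cobasis_notin.
Qed.

(** Concavity makes the slopes decrease. They are not all above 1, since the function is bounded
    above by 0, and not all at most 1, since the competitor [{v}] bounds it by an affine function of
    slope 2. *)
Lemma line_center K v E : v \in E ->
  exists m : int, let K0 := shift K (cobasis v *~ m) in
  (forall k, 0 <= k -> line K0 v E (k + 1) - line K0 v E k <= 1) /\
  (forall k, k < 0 -> 1 <= line K0 v E (k + 1) - line K0 v E k).
Proof.
move=> vE; have /andP[t0 t2] := t02; set H := line K v E.
have H0 k : H k <= 0.
  rewrite /H /line /tmin.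
  have := gmin_le0 (shift K (cobasis v *~ k)) E.
  by have := gmin_le0 (shift (shift K (cobasis v *~ k)) (dual0 Gamma)) E; nra.
have HB k : H k <= tweight K v + 2 * k%:~R.
  rewrite /H /line /tmin /tweight shiftAC.
  have := gmin_cobasis_upper K k vE.
  by have := gmin_cobasis_upper (shift K (dual0 Gamma)) k vE; nra.
have [|||m [mr ml]] := @exists_center _ (fun k => H (k + 1) - H k).
- move=> k; suff : H (k + 1 + 1) + H k <= 2 * H (k + 1) by lra.
  rewrite /H /line; set L := shift K (cobasis v *~ (k + 1)).
  have -> : shift K (cobasis v *~ (k + 1 + 1)) = shift L (cobasis v).
    by rewrite -[X in shift L X]mulr1z shift_cobasisD.
  have -> : shift K (cobasis v *~ k) = shift L (- cobasis v).
    by rewrite -[X in shift L X]mulrN1z shift_cobasisD addrK.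
  rewrite /tmin !(shiftAC L _ (dual0 Gamma)).
  have := gmin_cobasis_concave L v E; have := gmin_cobasis_concave (shift L
    (dual0 Gamma)) v E.
  nra.
- apply: contrapT => no.
  have D k : 1 < H (k + 1) - H k by rewrite ltNge; apply/negP => h; apply: no;
    exists k.
  have Hn (n : nat) : H 0 + n%:R <= H n.
    elim: n => [|n IH]; first by rewrite addr0.
    by have := D n; rewrite -addn1 natrD PoszD; lra.
  have := Hn (Num.truncn (- H 0)).+1; have := truncnS_gt (- H 0).
  by have := H0 (Num.truncn (- H 0)).+1; lra.
- apply: contrapT => no.
  have D k : H (k + 1) - H k <= 1 by rewrite leNgt; apply/negP => h; apply: no;
    exists k.
  have Hn (n : nat) : H 0 - n%:R <= H (- n%:Z).
    elim: n => [|n IH]; first by rewrite subr0 oppr0.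
    have := D (- n.+1%:Z); rewrite (_ : - n.+1%:Z + 1 = - n%:Z); last lia.
    by rewrite -addn1 natrD; lra.
  (* For this [n] the bounds [H 0 - n <= H (- n)] and [H (- n) <= tweight K v - 2 * n] are
     incompatible. *)
  set n := (Num.truncn (tweight K v - H 0)).+1.
  have := Hn n; have := truncnS_gt (tweight K v - H 0); rewrite -/n.
  by have := HB (- n%:Z); rewrite intrN -pmulrn; lra.
- have lE k : line (shift K (cobasis v *~ m)) v E k = H (m + k).
    by rewrite /H /line shift_cobasisD.
  by exists m; split=> k k0; rewrite !lE addrA; [apply: mr|apply: ml]; lia.
Qed.

End Weights.

(** * Restriction of classes to the graph without [v], and the map phi *)

Section Restriction.
Variables (R : realType) (Gamma : marked_graph) (v : vertex Gamma) (t : R).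
Hypothesis t02 : 0 <= t <= 2.
Local Notation V := (vertex Gamma).
Local Notation D := (del_vertex v).
Implicit Types (K : Char Gamma) (L : Char D) (E : {set V}) (F : {set vertex D}).

Lemma char_restrict_subproof K : char_pred (Gamma :=
  D) [ffun u => val K (val u)].
Proof. by apply/char_predP => u; rewrite ffunE; have /char_predP := valP K;
  apply. Qed.

Definition char_restrict K : Char D := Sub _ (char_restrict_subproof K).

Lemma char_extend_subproof L : char_pred (Gamma := Gamma)
  [ffun u => if insub u is Some u' then val L u' else weight Gamma u].
Proof.
apply/char_predP => u; rewrite ffunE; case: insubP => [u' _ <-|_].
  by have /char_predP := valP L; apply.
by rewrite subrr dvdz0.
Qed.

Definition char_extend L : Char Gamma := Sub _ (char_extend_subproof L).

Lemma char_extendK : cancel char_extend char_restrict.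
Proof. by move=> L; apply/val_inj/ffunP => u; rewrite !ffunE valK. Qed.

Definition set_restrict E : {set vertex D} := [set u | val u \in E]%SET.

Definition set_extend F : {set V} := [set val u | u in F]%SET.

Lemma set_extendK : cancel set_extend set_restrict.
Proof. by move=> F; apply/setP => u; rewrite inE mem_imset//;
  exact: val_inj. Qed.

Lemma notin_set_extend F : v \notin set_extend F.
Proof. by apply/imsetP => -[u _ vu]; have := valP u; rewrite -vu eqxx. Qed.

Lemma set_restrictK E : v \notin E -> set_extend (set_restrict E) = E.
Proof.
move=> vE; apply/setP => u; apply/imsetP/idP => [[u' + ->]|uE];
  first by rewrite inE.
have uv : u != v by apply: contraNneq vE => <-.
by exists (Sub u uv); rewrite ?inE SubK.
Qed.

Lemma card_set_restrict E : v \notin E -> #|set_restrict E| = #|E|.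
Proof.
by move=> vE; rewrite -{2}(set_restrictK vE) card_imset//; exact: val_inj.
Qed.

Lemma set_restrictU1 (u : vertex D) E : set_restrict (val u |: E) =
  u |: set_restrict E.
Proof. by apply/setP => w; rewrite !inE. Qed.

Lemma char_restrict_shift K (x : coH2 Gamma) (y : coH2 D) :
  (forall u, x (val u) = y u) -> char_restrict (shift K x) =
    shift (char_restrict K) y.
Proof.
by move=> xy; apply/val_inj/ffunP => u; rewrite ffunE !val_shift ffunE ffunMnE
  [RHS]ffunE ffunMnE ffunE xy.
Qed.

Lemma char_restrict_dual K (u : vertex D) :
  char_restrict (shift K (dual (val u))) = shift (char_restrict K) (dual u).
Proof. by apply: char_restrict_shift => w; rewrite !ffunE. Qed.

Lemma char_restrict_dualN K (u : vertex D) :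
  char_restrict (shift K (- dual (val u))) = shift (char_restrict K) (- dual u).
Proof. by apply: char_restrict_shift => w; rewrite !ffunE. Qed.

Lemma char_restrict_dual0 K :
  char_restrict (shift K (dual0 Gamma)) = shift (char_restrict K) (dual0 D).
Proof. by apply: char_restrict_shift => w; rewrite !ffunE. Qed.

Lemma char_restrict_cobasis K (k : int) :
  char_restrict (shift K (cobasis v *~ k)) = char_restrict K.
Proof.
rewrite -[RHS]shift0; apply: char_restrict_shift => u.
by rewrite cobasisz (negbTE (valP u)) ffunE.
Qed.

Lemma half_weight_restrict K F : half_weight R K (vset (set_extend F)) =
  half_weight R (char_restrict K) (vset F).
Proof.
have sumE (G : V -> int) : \sum_(u in set_extend F) G u =
  \sum_(u in F) G (val u).
  by rewrite big_imset //= => x y _ _; exact: val_inj.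
rewrite !half_weight_vset !sumE; congr ((_ + _)%:~R / _).
  by apply: eq_bigr => u _; rewrite ffunE.
by apply: eq_bigr => u _; rewrite sumE.
Qed.

Lemma gmin_restrict K E : v \notin E ->
  gmin R (char_restrict K) (set_restrict E) = gmin R K E.
Proof.
move=> vE; apply/eqP; rewrite eq_le; apply/andP; split; apply: gmin_ge => I IE.
  have vI : v \notin I by apply: contraNN vE; exact: (fintype.subsetP IE).
  rewrite -(set_restrictK vI) half_weight_restrict; apply: gmin_le.
  by apply/fintype.subsetP => u; rewrite !inE; exact: (fintype.subsetP IE).
rewrite -half_weight_restrict gmin_le//.
by apply/fintype.subsetP => _ /imsetP[u uI ->];
  have := fintype.subsetP IE _ uI; rewrite inE.
Qed.

Lemma tmin_restrict K E : v \notin E ->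
  tmin t (char_restrict K) (set_restrict E) = tmin t K E.
Proof. by move=> vE; rewrite /tmin -char_restrict_dual0 !gmin_restrict. Qed.

Lemma tweight_restrict K (u : vertex D) :
  tweight t (char_restrict K) u = tweight t K (val u).
Proof.
have h K' : half_weight R (char_restrict K') (vtx u) =
  half_weight R K' (vtx (val u)).
  by rewrite -!vset1 -half_weight_restrict /set_extend imset_set1.
by rewrite /tweight -char_restrict_dual0 !h.
Qed.

Lemma set_restrictD1 (u : vertex D) E : set_restrict (E :\ val u) =
  set_restrict E :\ u.
Proof. by apply/setP => w; rewrite !inE. Qed.

Lemma at_exp_restrict K E (u : vertex D) : v \notin E ->
  at_exp t (char_restrict K) (set_restrict E) u = at_exp t K E (val u).
Proof.
move=> vE; rewrite !at_expE -set_restrictD1 !tmin_restrict//.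
by rewrite !inE negb_and vE orbT.
Qed.

Lemma bt_exp_restrict K E (u : vertex D) : v \notin E ->
  bt_exp t (char_restrict K) (set_restrict E) u = bt_exp t K E (val u).
Proof.
move=> vE; rewrite !bt_expE -set_restrictD1 -char_restrict_dual
  tweight_restrict !tmin_restrict//.
by rewrite !inE negb_and vE orbT.
Qed.

(** Both values at [v] have the parity of the weight and so differ by an even number: the fibres of
    restriction are the lines of the overview. *)
Lemma char_restrict_eq K K' : char_restrict K = char_restrict K' ->
  exists k : int, K' = shift K (cobasis v *~ k).
Proof.
move=> KK'; have /char_predP/(_ v) cK := valP K;
  have /char_predP/(_ v) cK' := valP K'.
have : (2 %| val K' v - val K v)%Z.
  have -> : val K' v - val K v = (val K' v - weight Gamma v) - (val K v -
    weight Gamma v).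
    by ring.
  exact: rpredB.
move=> /dvdzP[k kE]; exists k; apply/val_inj/ffunP => u.
rewrite val_shift ffunE ffunMnE cobasisz; case: eqP => [->|/eqP uv].
  by rewrite -[k *+ 2]mulr_natr; move: kE => /eqP; rewrite subr_eq => /eqP ->;
    rewrite addrC.
rewrite mul0rn addr0; have /(congr1 (fun L => val L (Sub u uv))) := KK'.
by rewrite !ffunE SubK.
Qed.

(** The sum over all extensions, on coefficients: each extension with [v] outside [E] receives the
    coefficient of its restriction. *)
Definition phi_fun (f : CF R D) : CF R Gamma := fun KE =>
  if v \in KE.2 then 0 else f (char_restrict KE.1, set_restrict KE.2).

Lemma phi_is_linear : linear phi_fun.
Proof.
move=> a f g; apply/funext => -[K E].
rewrite -[RHS]/(a * phi_fun f (K, E) + phi_fun g (K, E)) /phi_fun /=.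
by case: ifP => _; rewrite ?mulr0 ?addr0.
Qed.

HB.instance Definition _ := GRing.isLinear.Build (long_series R) (CF R D) (CF R
  Gamma) *:%R
  phi_fun phi_is_linear.

Lemma phi_bd f : CFbd_fun t (phi_fun f) = phi_fun (CFbd_fun t f).
Proof.
apply/funext => -[K E]; rewrite /phi_fun /=; case: ifPn => vE.
  apply: big1 => u uE; rewrite finset.inE vE orbT !mulr0 addr0//.
(* The summand of [v] reads [phi_fun f] at sets containing [v], where it vanishes. *)
rewrite (bigID (fun u => u == v)) /= big1 ?add0r; last first.
  by move=> u /andP[_ /eqP->]; rewrite !finset.inE eqxx /= !mulr0 addr0.
rewrite (reindex_omap (val : vertex D -> V) insub) /=; last first.
  by move=> u /andP[_ uv]; rewrite insubT.
apply: eq_big => [u|u /andP[/andP[uE uv] _]].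
  by rewrite finset.inE valK eqxx andbT (valP u) andbT.
have vuE : v \notin val u |: E by rewrite !inE negb_or eq_sym uv.
rewrite (negbTE vuE) -set_restrictU1 -char_restrict_dualN.
by rewrite at_exp_restrict// bt_exp_restrict.
Qed.

Lemma phi_grade p f : f \in CFgrade p -> phi_fun f \in CFgrade p.
Proof.
move=> /asboolP hf; apply/asboolP => K E; rewrite /phi_fun /=.
by case: ifPn => [_ /eqP//|vE /hf]; rewrite card_set_restrict.
Qed.

Lemma phi_inj f : phi_fun f = 0 -> f = 0.
Proof.
move=> f0; apply/funext => -[L F].
have := congr1 (fun g : CF R Gamma => g (char_extend L, set_extend F)) f0.
by rewrite /phi_fun /= (negbTE (notin_set_extend F)) char_extendK set_extendK.
Qed.

Definition phi : chain_map (CFt D t02) (CFt Gamma t02) :=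
  @ChainMap _ (CFt D t02) (CFt Gamma t02) phi_fun phi_bd phi_grade.

End Restriction.

(** * Increasing the weight of [v], and the map psi *)

Section WeightIncrease.
Variables (R : realType) (Gamma : marked_graph) (v : vertex Gamma) (t : R).
Hypothesis t02 : 0 <= t <= 2.
Local Notation V := (vertex Gamma).
Local Notation G1 := (incr_weight v).
Implicit Types (K : Char Gamma) (L : Char G1) (E : {set V}).

Lemma char_up_subproof L : char_pred (Gamma := Gamma) ((val L : coH2 Gamma) +
  cobasis v).
Proof.
apply/char_predP => u; have /char_predP/(_ u) := valP L.
rewrite !ffunE /=; case: eqP => _; last by rewrite addr0.
move=> h; have -> : val L u + 1%:Z - weight Gamma u =
  val L u - (weight Gamma u + 1) + 2 by ring.
exact: rpredD.
Qed.

(** The shift by [d] repairs the parity at [v]. Its inverse [char_down] accounts for the odd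
    multiple [(2j-1)d] in the formula for psi. *)
Definition char_up L : Char Gamma := Sub _ (char_up_subproof L).

Lemma char_down_subproof K : char_pred (Gamma := G1) ((val K : coH2 Gamma) -
  cobasis v).
Proof.
apply/char_predP => u; have /char_predP/(_ u) := valP K.
rewrite !ffunE /=; case: eqP => _; last by rewrite subr0.
move=> h; have -> : val K u - 1%:Z - (weight Gamma u + 1) =
  val K u - weight Gamma u - 2 by ring.
exact: rpredB.
Qed.

Definition char_down K : Char G1 := Sub _ (char_down_subproof K).

Lemma char_downK : cancel char_down char_up.
Proof. by move=> K; apply/val_inj; rewrite /= subrK. Qed.

Lemma char_upK : cancel char_up char_down.
Proof. by move=> K; apply/val_inj; rewrite /= addrK. Qed.

Lemma char_up_shift L (x : coH2 Gamma) : char_up (@shift G1 L x) =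
  shift (char_up L) x.
Proof. by apply/val_inj; rewrite /= addrAC. Qed.

Lemma dual_incr (u : V) : @dual G1 u = dual u + if u == v then cobasis v else 0.
Proof.
apply/ffunP => w; rewrite !ffunE /vdot /=; have [<-|uw] := eqVneq u w.
  by case: ifP => uv; rewrite ffunE ?uv ?addr0.
case: ifP => [/eqP uv|]; rewrite ffunE ?addr0//.
by rewrite eq_sym -uv (negbTE uw) addr0.
Qed.

(** The extra 1 in the self-intersection of [v] matches the value 1 of [d] on [v]; both count
    exactly when [v] lies in [I]. *)
Lemma half_weight_up L (I : {set V}) :
  half_weight R L (@vset G1 I) = half_weight R (char_up L) (vset I).
Proof.
rewrite !half_weight_vset; congr (_%:~R / _).
rewrite -!big_split /=; apply: eq_bigr => u uI.
have vdotE w : @vdot G1 u w = vdot u w + if (u == v) && (w == v) then 1 else 0.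
  rewrite /vdot /=; have [<-|uw] := eqVneq u w.
    by rewrite andbb; case: ifP; rewrite ?addr0.
  by case: eqP => [uv|]; rewrite ?addr0//= eq_sym -uv (negbTE uw) addr0.
rewrite (eq_bigr _ (fun w _ => vdotE w)) big_split /= !ffunE -addrA;
  congr (_ + _).
rewrite addrC; congr (_ + _).
have [uv|uv] /= := eqVneq u v; last by rewrite big1.
by rewrite -big_mkcondr (big_pred1 v)// => w /=; case: eqP => [->|];
  rewrite ?andbF// -uv uI.
Qed.

Lemma gmin_up L E : gmin R L E = gmin R (char_up L) E.
Proof. by apply: eq_bigr => I _; rewrite half_weight_up. Qed.

Lemma tmin_up L E : tmin t L E = tmin t (char_up L) E.
Proof. by rewrite /tmin !gmin_up char_up_shift. Qed.

Lemma tweight_up L (u : V) : @tweight R G1 t L u = tweight t (char_up L) u.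
Proof. by rewrite /tweight -!vset1 !half_weight_up char_up_shift. Qed.

(** Each line is based at the class where the coefficient is wanted, hence position 0; [psi_theta]
    frees the base point. *)
Definition psi_fun (f : CF R Gamma) : CF R G1 := fun LE =>
  theta (line t (char_up LE.1) v LE.2) 
    (fun l => f (shift (char_up LE.1) (cobasis v *~ l), LE.2)) 0.

Lemma psi_is_linear : linear psi_fun.
Proof.
move=> a f g; apply/funext => -[L E].
rewrite -[RHS]/(a * psi_fun f (L, E) + psi_fun g (L, E)) /psi_fun.
by rewrite -theta_linear //; apply: line_slope.
Qed.

HB.instance Definition _ := GRing.isLinear.Build (long_series R) (CF R Gamma)
  (CF R G1) *:%R
  psi_fun psi_is_linear.

Lemma psi_theta f K E k : psi_fun f (char_down (shift K (cobasis v *~ k)), E) =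
  theta (line t K v E) (fun l => f (shift K (cobasis v *~ l), E)) k.
Proof.
have := theta_translate (line t K v E) (fun l => f (shift K (cobasis v *~ l),
  E)) k 0.
rewrite add0r => <-; rewrite /psi_fun /= char_downK.
have lE : line t (shift K (cobasis v *~ k)) v E = fun l => line t K v E (l + k).
  by apply/funext => l; rewrite /line shift_cobasisD addrC.
rewrite lE; congr (theta _ _ 0); apply/funext => l.
by rewrite shift_cobasisD addrC.
Qed.

Lemma psi_fun0 f E K : psi_fun f (char_down K, E) =
  theta (line t K v E) (fun l => f (shift K (cobasis v *~ l), E)) 0.
Proof. by rewrite -psi_theta mulr0z shift0. Qed.

Lemma char_down_shift K (x : coH2 Gamma) : char_down (shift K x) =
  @shift G1 (char_down K) x.
Proof. by rewrite -[RHS]char_upK char_up_shift char_downK. Qed.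

Lemma at_exp_down K E (u : V) : @at_exp R G1 t (char_down K) E u =
  at_exp t K E u.
Proof. by rewrite !at_expE !tmin_up char_downK. Qed.

Lemma bt_exp_down K E (u : V) : @bt_exp R G1 t (char_down K) E u =
  tmin t (shift K (dual u + if u == v then cobasis v else 0)) (E :\ u) - tmin t
    K E + tweight t K u.
Proof.
by rewrite !bt_expE !tmin_up tweight_up char_up_shift !char_downK dual_incr.
Qed.

Lemma tweight_cobasis K u k : tweight t (shift K (cobasis v *~ k)) u =
  tweight t K u + if u == v then 2 * k%:~R else 0.
Proof.
rewrite /tweight -!vset1 !(shiftAC _ (cobasis v *~ k)) !half_weight_cobasis
  !finset.inE eq_sym.
by case: eqP => _; ring.
Qed.

Local Notation along K j := (shift K (cobasis v *~ (0 - j))).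

Lemma theta_term_rated K E (g : Char Gamma -> long_series R) :
  zrated (fun j => qpow (theta_exp (line t K v E) 0 j) * g (along K j)).
Proof.
exact: (@theta_rated _ _ (line_slope t02 K v E) (fun l =>
  g (shift K (cobasis v *~ l))) 0).
Qed.

(** The exponents of theta and of the differential are differences of [tmin], up to [j * (j - 1)],
    and telescope to the same total on both sides. *)
Lemma psi_bd_a f K E u : u \notin E ->
  qpow (at_exp t K (u |: E) u) * psi_fun f (char_down K, u |: E) =
  zsum (fun j => qpow (theta_exp (line t K v E) 0 j) *
    (qpow (at_exp t (along K j) (u |: E) u) * f (along K j, u |: E))).
Proof.
move=> uE; have slope F := line_slope t02 K v F.
rewrite psi_fun0 /theta -zsumZ; last exact: (@theta_term_rated K (u |: E) (fun
  K' => f (K', u |: E))).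
apply: eq_zsum => j; rewrite !qpowM ?theta_exp_ge0 ?at_exp_ge0//.
congr (qpow _ * _); rewrite !at_expE finset.setU1K// /theta_exp /line mulr0z
  shift0.
by ring.
Qed.

Lemma psi_bd_b f K E u : u \notin E ->
  qpow (@bt_exp R G1 t (@shift G1 (char_down K) (- @dual G1 u)) (u |: E) u) *
    psi_fun f (@shift G1 (char_down K) (- @dual G1 u), u |: E) =
  zsum (fun j => qpow (theta_exp (line t K v E) 0 j) *
    (qpow (bt_exp t (shift (along K j) (- dual u)) (u |: E) u) *
     f (shift (along K j) (- dual u), u |: E))).
Proof.
move=> uE; rewrite -char_down_shift dual_incr; set b := if _ then _ else _.
have bt0 := @bt_exp_ge0 R G1 t (char_down (shift K (- (dual u + b)))) (u |: E)
  u t02 (finset.setU11 u E).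
set M := shift K _ in bt0 *.
have slope K' F := line_slope t02 K' v F.
rewrite psi_fun0 /theta -zsumZ; last exact: (@theta_term_rated _ _ (fun K' =>
  f (K', u |: E))).
set y := fun j => _; set x := fun j => _.
have xr : zrated x.
  exact: (@theta_term_rated K E (fun K' => qpow (bt_exp t (shift K' (- dual u))
    (u |: E) u) *
    f (shift K' (- dual u), u |: E))).
have yr : zrated y by move=> j; apply: vge_mull;
  exact: (@theta_term_rated M (u |: E) (fun K' => f (K', u |: E))).
(* The classes [v^*] of the two graphs differ by [cobasis v], whence a shift of
   the summation index when [u = v]. *)
pose e : int := (u == v)%:Z.
have yx j : y j = x (j + e).
  rewrite /y /x !qpowM ?theta_exp_ge0 ?bt_exp_ge0 ?finset.setU11//.
  have hM : shift (along K (j + e)) (- dual u) = along M j.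
    rewrite /M !shift_shift; congr (shift K _); rewrite /b /e; case: eqP => _.
      rewrite (_ : 0 - (j + true) = (0 - j) - 1); last by rewrite opprD addrA.
      by rewrite mulrzBr mulr1z opprD [RHS]addrC addrA addrAC.
    by rewrite !addr0 addrC.
  rewrite hM; congr (qpow _ * _).
  have -> : bt_exp t (along M j) (u |: E) u = tmin t (along K (j + e)) E -
      tmin t (along M j) (u |: E) + tweight t (along M j) u.
    by rewrite bt_expE finset.setU1K// -{1}hM shiftNK.
  rewrite bt_exp_down finset.setU1K// -/b {1}/M shiftNK tweight_cobasis.
  rewrite /theta_exp /line !mulr0z !shift0 /e.
  case: eqP => _; last by rewrite !addr0; ring.
  (* [(j + 1) * j] exceeds [j * (j - 1)] by [2 * j], exactly what [tweight] at [v] loses from [M] to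
     [along M j]. *)
  by rewrite addrK [(j + 1) * j]mulrDl mulrBr !intrD intrN; ring.
have xer : zrated (fun j => x (j + e)) by move=> j; rewrite -yx; exact: yr.
rewrite (eq_zsum yx); move: xer; rewrite /e; case: eqP => _ xer.
  exact: zsum_shift.
by apply: eq_zsum => j; rewrite addr0.
Qed.

Lemma psi_bd f : CFbd_fun t (psi_fun f) = psi_fun (CFbd_fun t f).
Proof.
apply/funext => -[L E] /=; rewrite -[L]char_upK; move: (char_up L) => K {L}.
rewrite psi_fun0 /theta /=.
under [in RHS]eq_zsum => j do rewrite mulr_sumr.
rewrite zsum_sum; apply: eq_bigr => u uE.
rewrite at_exp_down psi_bd_a// psi_bd_b// -zsumD.
by apply: eq_zsum => j; rewrite mulrDr.
Qed.

Lemma psi_grade p f : f \in CFgrade p -> psi_fun f \in CFgrade p.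
Proof.
move=> /asboolP hf; apply/asboolP => L E; apply: contra_neqP => pE.
rewrite /psi_fun -[RHS](zsum0 R); apply: eq_zsum => j.
suff -> : f (shift (char_up L) (cobasis v *~ (0 - j)), E) = 0 by rewrite mulr0.
by apply: contra_notP pE => /eqP/hf.
Qed.

Definition psi : chain_map (CFt Gamma t02) (CFt G1 t02) :=
  @ChainMap _ (CFt Gamma t02) (CFt G1 t02) psi_fun psi_bd psi_grade.

Lemma psi_phi f : psi_fun (@phi_fun R Gamma v f) = 0.
Proof.
apply/funext => -[L E]; rewrite -[L]char_upK; move: (char_up L) => K {L}.
rewrite psi_fun0 /phi_fun /=; have [vE|/negPf vE] := boolP (v \in E).
  rewrite -[RHS](zsum0 R) /theta; apply: eq_zsum => j.
  by rewrite mulr0.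
have -> : (fun l => f (char_restrict v (shift K (cobasis v *~ l)),
  set_restrict v E)) =
    fun=> f (char_restrict v K, set_restrict v E).
  by apply/funext => l; rewrite char_restrict_cobasis.
exact: (theta_of_const (fun k => line_const t K k (negbT vE))).
Qed.

Lemma psi_ker p f : f \in CFgrade p -> psi_fun f = 0 ->
  exists2 g : CF R (del_vertex v), g \in CFgrade p & phi_fun g = f.
Proof.
move=> /asboolP fp f0.
have th0 K E k : theta (line t K v E) (fun l => f (shift K (cobasis v *~ l),
  E)) k = 0.
  by rewrite -psi_theta f0.
(* For [v] in [E], theta based at the centre of the line is injective, which forces [f] to vanish
   there. *)
have fv K E : v \in E -> f (K, E) = 0.
  move=> vE; have [m [mr ml]] := line_center t02 K vE.
  set K0 := shift K (cobasis v *~ m) in mr ml.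
  have -> : K = shift K0 (cobasis v *~ (- m)) by rewrite shift_cobasisD subrr
    mulr0z shift0.
  suff cE : (fun l => f (shift K0 (cobasis v *~ l), E)) = fun=> 0.
    exact: (congr1 (fun c => c (- m)) cE).
  apply: (@theta_inj _ _ (line_slope t02 K0 v E) mr ml _ (fun=> 0)) => k;
    rewrite th0.
  by rewrite -[LHS](zsum0 R); apply: eq_zsum => j; rewrite mulr0.
(* The preimage reads [f] at one extension of each class; constancy of [f] along lines makes the
   choice immaterial. *)
exists (fun LF => f (char_extend LF.1, set_extend LF.2)).
  apply/asboolP => L F /= /fp <-; congr (_%:Z).
  by rewrite card_imset//; exact: val_inj.
apply/funext => -[K E]; rewrite /phi_fun /=; case: ifPn => vE;
  first by rewrite fv.
rewrite set_restrictK//.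
have [k {2}->] := char_restrict_eq (char_extendK (char_restrict v K)).
have := theta_const_ker (fun k => line_const t _ k vE) (th0 (char_extend
  (char_restrict v K)) E).
by move=> /(congr1 (fun c => c k)) ->; rewrite mulr0z shift0.
Qed.

Lemma psi_surj p g : g \in CFgrade p ->
  exists2 f : CF R Gamma, f \in CFgrade p & psi_fun f = g.
Proof.
move=> /asboolP gp.
have lift (KE : Char Gamma * {set V}) : {c : int -> long_series R |
    forall k, theta (line t KE.1 v KE.2) c k = g (char_down (shift KE.1
      (cobasis v *~ k)), KE.2)}.
  case: KE => K E; apply: cid => /=; have [vE|vE] := boolP (v \in E);
    last first.
    exact: (theta_const_surj (fun k => line_const t K k vE)).
  have [m [mr ml]] := line_center t02 K vE.
  set K0 := shift K (cobasis v *~ m) in mr ml.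
  have [c hc] := theta_surj (line_slope t02 K0 v E) mr ml
    (fun k => g (char_down (shift K0 (cobasis v *~ k)), E)).
  exists (fun l => c (l - m)) => k.
  have KK0 l : shift K (cobasis v *~ l) = shift K0 (cobasis v *~ (l - m)).
    by rewrite shift_cobasisD addrC subrK.
  have -> : line t K v E = fun l => line t K0 v E (l - m).
    by apply/funext => l; rewrite /line KK0.
  by rewrite (theta_translate (line t K0 v E)) hc KK0.
(* The lifts must be chosen once per line: [base K] depends only on the line of [K], and [ht K] is
   the position of [K] relative to it. *)
pose ht K : int := (val K v %/ 2)%Z.
pose base K := shift K (cobasis v *~ (- ht K)).
have ht_shift K k : ht (shift K (cobasis v *~ k)) = ht K + k.
  rewrite /ht val_shift ffunE ffunMnE cobasisz eqxx -[k *+ 2]mulr_natr.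
  by rewrite addrC divzMDl// addrC.
have base_shift K k : base (shift K (cobasis v *~ k)) = base K.
  by rewrite /base ht_shift shift_cobasisD opprD addrCA subrr addr0.
(* Coefficients outside degree [p] are set to 0 to make the lift homogeneous. *)
pose f : CF R Gamma := fun KE =>
  if #|KE.2|%:Z == p then sval (lift (base KE.1, KE.2)) (ht KE.1) else 0.
exists f.
  by apply/asboolP => K E; rewrite /f /=; case: ifP => [/eqP->|_] //;
    rewrite eqxx.
apply/funext => -[L E]; rewrite -[L]char_upK; move: (char_up L) => K {L}.
have [Ep|Ep] := eqVneq #|E|%:Z p; last first.
  transitivity (0 : long_series R); last first.
    by apply/esym; apply: contra_neqP Ep => /eqP/gp.
  rewrite psi_fun0 -[RHS](zsum0 R); apply: eq_zsum => j.
  by rewrite /f /= (negbTE Ep) mulr0.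
have KE : shift (base K) (cobasis v *~ ht K) = K.
  by rewrite /base shift_cobasisD addNr mulr0z shift0.
have fE : (fun l => f (shift (base K) (cobasis v *~ l), E)) =
  sval (lift (base K, E)).
  apply/funext => l; rewrite /f /= Ep eqxx base_shift ht_shift.
  have -> : ht (base K) = 0 by rewrite /base ht_shift subrr.
  by rewrite add0r /base ht_shift subrr oppr0 mulr0z shift0.
by rewrite -[K in char_down K]KE psi_theta fE (svalP (lift (base K, E))).
Qed.

End WeightIncrease.

Theorem theorem1p4 (R : realType) (Gamma : marked_graph) (v : vertex Gamma)
    (Gamma_tree : is_tree Gamma)
    (G_negdef : negative_definite Gamma)
    (v_v0 : ~~ adj Gamma None (Some v))
    (G1_negdef : negative_definite (incr_weight v))
    (t : R) (t02 : 0 <= t <= 2) :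
  exists (phi : chain_map (CFt (del_vertex v) t02) (CFt Gamma t02))
         (psi : chain_map (CFt Gamma t02) (CFt (incr_weight v) t02))
         (delta : forall p : int,
            {linear tHFK (incr_weight v) t02 p ->
                    tHFK (del_vertex v) t02 (p - 1)}),
  forall p : int,
    [/\ exact_at (hmap phi (p := p)) (hmap psi (p := p)),
        exact_at (hmap psi (p := p)) (delta p) &
        exact_at (delta p) (hmap phi (p := p - 1))].
Proof.
exists (phi v t02), (psi v t02); apply: long_exact_sequence.
- exact: phi_inj.
- exact: psi_phi.
- by move=> p f fp /(psi_ker t02 fp).
- by move=> p g gp; exact: (psi_surj t02 gp).
Qed.
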